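(* There is a universal constant $c>0$ such that for all integers $d,\tau\ge1$ and reals $\mu,\sigma_1>0$ the following holds for all sufficiently large $N$. For any (possibly randomized) algorithm with one-point feedback making $N$ oracle calls and returning $\hat x_N\in\mathbb{R}^d$, there exists a one-point instance with parameters $(d,\tau,\mu,\sigma_1)$ such that $$\mathbb{E}\|\hat x_N-x^*\|^2\ge c\,\frac{\sqrt{d\tau\sigma_1^2}}{\mu\sqrt N}.$$
   Context: Norms are Euclidean. A one-point instance with parameters $(d,\tau,\mu,\sigma_1)$ consists of a complete separable metric space $\mathsf{Z}$ with its Borel $\sigma$-algebra, a stationary Markov chain $\{Z_i\}$ on it with kernel $\mathrm{Q}$ and unique invariant distribution $\pi$ satisfying $\sup_{z,z'}\frac12\|\mathrm{Q}^k(z,\cdot)-\mathrm{Q}^k(z',\cdot)\|_{\mathsf{TV}}\le(1/4)^{\lfloor k/\tau\rfloor}$ for all $k\in\mathbb{N}$, and a function $F:\mathbb{R}^d\times\mathsf{Z}\to\mathbb{R}$ such that $f(x)=\mathbb{E}_{Z\sim\pi}[F(x,Z)]$ is differentiable with $L$-Lipschitz gradient for some $L>0$, is $\mu$-strongly convex ($\frac\mu2\|x-y\|^2\le f(x)-f(y)-\langle\nabla f(y),x-y\rangle$ for all $x,y$), and $\mathbb{E}_\pi|F(x,Z)-f(x)|^2\le\sigma_1^2$ for all $x\in\mathbb{R}^d$. $x^*$ is the minimizer of $f$. One-point feedback: the $k$-th oracle call, at a point $x_k$ chosen by the algorithm from its previous observations and internal randomness, returns $F(x_k,Z_k)$. 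*)

(* Defs.v *)
From HB Require Import structures.
From mathcomp Require Import all_boot all_order all_algebra.
From mathcomp Require Import all_classical all_reals all_analysis.

Set Implicit Arguments.
Unset Strict Implicit.
Unset Printing Implicit Defensive.

Import Order.TTheory GRing.Theory Num.Theory.
Import numFieldNormedType.Exports.

Local Open Scope classical_set_scope.
Local Open Scope ring_scope.

(* The library's [`|x|] on ['rV[R]_d] is the sup norm, hence [enorm]. *)
Definition dotv (R : realType) (d : nat) (x y : 'rV[R]_d) : R :=
  \sum_(i < d) x ord0 i * y ord0 i.

Definition enorm (R : realType) (d : nat) (x : 'rV[R]_d) : R :=
  Num.sqrt (dotv x x).

Definition gradient (R : realType) (d : nat) (f : 'rV[R]_d -> R^o)
    (x : 'rV[R]_d) : 'rV[R]_d :=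
  \row_(i < d) ('d f x (delta_mx ord0 i : 'rV[R]_d)).

Definition strongly_convex (R : realType) (d : nat) (mu : R)
    (f : 'rV[R]_d -> R^o) : Prop :=
  forall x y : 'rV[R]_d,
    mu / 2 * enorm (x - y) ^+ 2 <= f x - f y - dotv (gradient f y) (x - y).

(* [Complete] requires a point; this loses nothing, since the spaces below
   carry a probability measure. *)
#[short(type="completeMetricType")]
HB.structure Definition CompleteMetric (R : numDomainType) :=
  {Z of Metric R Z & Complete Z}.

Definition separable (T : topologicalType) : Prop :=
  exists2 S : set T, countable S & dense S.

Notation borel T := (g_sigma_algebraType (@open T)).

Section MarkovKernel.
Context (disp : measure_display) (T : measurableType disp) (R : realType).

Fixpoint kernel_iter (Q : R.-pker T ~> T) (k : nat) : R.-spker T ~> T :=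
  if k is k'.+1 then mkcomp_noparam (kernel_iter Q k') Q
  else kdirac (@measurable_id _ T setT).

Definition kernel_iter_at (Q : R.-pker T ~> T) (k : nat) (z : T)
    : set T -> \bar R := kernel_iter Q k z.

HB.instance Definition _ (Q : R.-pker T ~> T) (k : nat) (z : T) :=
  Measure.on (kernel_iter_at Q k z).

Lemma kernel_iter_at_finite (Q : R.-pker T ~> T) (k : nat) (z : T) :
  fin_num_fun (kernel_iter_at Q k z).
Proof.
move=> A mA; rewrite ge0_fin_numE//.
rewrite (@le_lt_trans _ _ 1%E) ?ltry//.
rewrite (le_trans _ (sprob_kernel_le1 (kernel_iter Q k) z))//.
by apply: le_measure; rewrite ?inE.
Qed.

HB.instance Definition _ (Q : R.-pker T ~> T) (k : nat) (z : T) :=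
  Measure_isFinite.Build _ _ _ (kernel_iter_at Q k z)
    (@kernel_iter_at_finite Q k z).

Definition invariant_distribution (Q : R.-pker T ~> T) (m : probability T R)
    : Prop :=
  forall A : set T, measurable A -> (\int[m]_z Q z A = m A)%E.

Definition charge_sub (m1 m2 : {finite_measure set T -> \bar R})
    : {charge set T -> \bar R} :=
  cadd (charge_of_finite_measure m1) (copp (charge_of_finite_measure m2)).

(* The mass [|nu|(T)]; it does not depend on the Hahn decomposition chosen. *)
Definition tv_norm (nu : {charge set T -> \bar R}) : \bar R :=
  let hP := cid (Hahn_decomposition nu) in
  let hN := cid (projT2 hP) in
  charge_variation (projT2 hN) setT.

End MarkovKernel.

Definition natural_filtration (dO dT : measure_display)
    (Omega : measurableType dO) (T : measurableType dT) (X : nat -> Omega -> T)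
    (n : nat) : set (set Omega) :=
  <<s \bigcup_(i in [set i | (i <= n)%N])
        preimage_set_system setT (X i) measurable >>.

(* The second clause is [P(X_(n+1) \in A | X_0, ..., X_n) = Q(X_n, A)] a.s. *)
Definition markov_chain (R : realType) (dO dT : measure_display)
    (Omega : measurableType dO) (T : measurableType dT)
    (P : probability Omega R) (Q : R.-pker T ~> T) (m : probability T R)
    (X : nat -> {RV P >-> T}) : Prop :=
  (forall A : set T, measurable A -> distribution P (X 0%N) A = m A) /\
  forall (n : nat) (A : set T) (B : set Omega), measurable A ->
    natural_filtration X n B ->
    P (B `&` X n.+1 @^-1` A) = (\int[P]_(w in B) Q (X n w) A)%E.

Definition stationary_process (R : realType) (dO dT : measure_display)
    (Omega : measurableType dO) (T : measurableType dT)
    (P : probability Omega R) (X : nat -> {RV P >-> T}) : Prop :=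
  forall (s n : nat) (A : nat -> set T), (forall i, measurable (A i)) ->
    P (\big[setI/setT]_(i < n) (X (s + i)%N @^-1` A i)) =
    P (\big[setI/setT]_(i < n) (X i @^-1` A i)).

Record one_point_data (R : realType) (d : nat) := OnePointData {
  op_space : completeMetricType R;
  op_kernel : R.-pker (borel op_space) ~> (borel op_space);
  op_inv : probability (borel op_space) R;
  op_disp : measure_display;
  op_Omega : measurableType op_disp;
  op_P : probability op_Omega R;
  op_chain : nat -> {RV op_P >-> borel op_space};
  op_F : 'rV[R]_d -> borel op_space -> R }.
Arguments op_F {R d} I x z : rename.
Arguments op_chain {R d} I _ : rename.

Definition objective (R : realType) (d : nat) (I : one_point_data R d)
    (x : 'rV[R]_d) : R^o :=
  fine ('E_(op_inv I)[op_F I x])%E.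

Record one_point_instance (R : realType) (d tau : nat) (mu sigma1 : R)
    (I : one_point_data R d) : Prop := {
  op_separable : separable (op_space I);
  op_invariant : invariant_distribution (op_kernel I) (op_inv I);
  op_unique : forall m : probability (borel (op_space I)) R,
    invariant_distribution (op_kernel I) m ->
    forall A : set (borel (op_space I)), measurable A -> m A = op_inv I A;
  op_mixing : forall (k : nat) (z z' : op_space I),
    ((1 / 2)%:E * tv_norm (charge_sub (kernel_iter_at (op_kernel I) k z)
                                      (kernel_iter_at (op_kernel I) k z'))
       <= ((1 / 4) ^+ (k %/ tau))%:E)%E;
  op_markov : markov_chain (op_kernel I) (op_inv I) (op_chain I);
  op_stationary : stationary_process (op_chain I);
  (* Joint measurability makes the observations [F(x_k, Z_k)] random
     variables. *)
  op_F_measurable : measurable_fun setT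
    (fun xz : borel 'rV[R]_d * borel (op_space I) => op_F I xz.1 xz.2);
  op_F_integrable : forall x : 'rV[R]_d,
    (op_inv I).-integrable setT (EFin \o op_F I x);
  op_differentiable : forall x : 'rV[R]_d, differentiable (objective I) x;
  op_smooth : exists2 L : R, 0 < L & forall x y : 'rV[R]_d,
    enorm (gradient (objective I) x - gradient (objective I) y)
      <= L * enorm (x - y);
  op_convex : strongly_convex mu (objective I);
  op_variance : forall x : 'rV[R]_d,
    ('E_(op_inv I)[fun z => (`|op_F I x z - objective I x| ^+ 2)%R]
       <= (sigma1 ^+ 2)%:E)%E }.

Definition minimizer (R : realType) (d : nat) (f : 'rV[R]_d -> R^o)
    (xs : 'rV[R]_d) : Prop :=
  forall x : 'rV[R]_d, f xs <= f x.

(* [alg_query k (u, y)] is the point of call number [k] (from 0), given the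
   internal randomness [u], drawn once from [alg_law], and the answers [y] to
   the calls [0, ..., k - 1]; only the queries with [k < N] are used. Earlier
   query points are functions of [(u, y)]. *)
Record one_point_algorithm (R : realType) (d N : nat) := OnePointAlgorithm {
  alg_disp : measure_display;
  alg_seed : measurableType alg_disp;
  alg_law : probability alg_seed R;
  alg_query : forall k : nat, alg_seed * k.-tuple R -> 'rV[R]_d;
  alg_output : alg_seed * N.-tuple R -> 'rV[R]_d;
  alg_query_measurable : forall k : nat, measurable_fun setT
    (@alg_query k : alg_seed * k.-tuple R -> borel 'rV[R]_d);
  alg_output_measurable : measurable_fun setT
    (alg_output : alg_seed * N.-tuple R -> borel 'rV[R]_d) }.
Arguments alg_query {R d N} a {k} uy : rename.
Arguments alg_output {R d N} a uy : rename.

Section Run.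
Context (R : realType) (d N : nat).
Context (a : one_point_algorithm R d N) (I : one_point_data R d).

Fixpoint observations (u : alg_seed a) (w : op_Omega I) (k : nat)
    : k.-tuple R :=
  if k is k'.+1 then
    let y := observations u w k' in
    [tuple of rcons y (op_F I (alg_query a (u, y)) (op_chain I k' w))]
  else [tuple].

Definition estimate (u : alg_seed a) (w : op_Omega I) : 'rV[R]_d :=
  alg_output a (u, observations u w N).

(* The product law makes the internal randomness independent of the chain. *)
Definition risk (xs : 'rV[R]_d) : \bar R :=
  (\int[alg_law a \x op_P I]_uw (enorm (estimate uw.1 uw.2 - xs) ^+ 2)%:E)%E.

End Run.

(* Main.v *)
Require Import Defs.
From HB Require Import structures.
From mathcomp Require Import all_boot all_order all_algebra.
From mathcomp Require Import all_classical all_reals all_analysis.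
From mathcomp Require Import measurable_realfun ring lra.

(** The lower bound is an Assouad argument over the [2 ^ d] sign vectors [v], in
    which the oracle function is the same for all [v] and only the law of the
    Markov chain depends on [v].

    The state space is the cube [{-1, 1}^d] with the discrete metric. Under [v]
    the stationary law makes the coordinates independent signs, the [j]-th with
    mean [eps * v_j]. The chain keeps its state with probability [1 - p] and
    otherwise redraws it from the stationary law, so that the laws after [k]
    steps differ by at most [(1 - p) ^ k] in total variation; [p] of order
    [1 / tau] gives the required mixing.

    The oracle at [x] in state [z] is
    [mu * \sum_j (375 / 169 * x_j ^ 2 - (z_j / eps) * D ^ 2 * psi (x_j / D))]
    with [psi t = t / (1 + t ^ 2)]. In the mean, [z_j / eps] becomes [v_j], and
    the objective is a sum of one-dimensional wells whose minimizers are
    [v_j * D / 5]. As [psi] is bounded and agrees with its linear approximation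
    up to [3 / 2] times the squared increment, the objective is [mu]-strongly
    convex and smooth, while the noise has variance at most
    [d * (mu * D ^ 2 / (2 * eps)) ^ 2]. The standard deviation [sigma1] thus
    allows [D ^ 2] of order [eps * sigma1 / (mu * sqrt d)].

    Since the oracle does not involve [v], the whole run of the algorithm is a
    function of its seed and of the path of the chain, however adaptively the
    query points are chosen. Two sign vectors that differ in one coordinate give
    path laws whose Hellinger affinity is at least
    [(1 - eps ^ 2) * (1 - p * eps ^ 2) ^ (N - 1)]: only the roughly [N * p]
    redraws carry information, each of order [eps ^ 2]. With [eps ^ 2] a small
    multiple of [tau / N] the affinity is at least [3 / 4] ([overlap_mass]), no
    estimator can tell the two minimizers apart ([two_point_sqr]), and the average
    over [v] of the risks is at least [d * (D / 5) ^ 2 / 2] ([assouad]). This is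
    [sqrt d * eps * sigma1 / (25 * mu)], of the announced order, and some [v] has
    at least the average risk ([exists_hard_instance]).

    The chain itself is built on [[0, 1)] with Lebesgue measure: the event that
    the path starts with a given word is an interval whose length is the weight
    of the word ([exists_process]). *)

Import Order.TTheory GRing.Theory Num.Theory.
Import numFieldNormedType.Exports.

Local Open Scope classical_set_scope.
Local Open Scope ring_scope.

Set Implicit Arguments.
Unset Strict Implicit.

(** * A bounded function with a quadratic Taylor remainder *)

Definition psi {R : realFieldType} (t : R) : R := t / (1 + t ^+ 2).
Definition dpsi {R : realFieldType} (t : R) : R := (1 - t ^+ 2) / (1 + t ^+ 2) ^+ 2.

Section Psi.
Context {R : realFieldType}.
Implicit Types x y t : R.

Lemma psi_bounded t : psi t ^+ 2 <= 1 / 4.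
Proof.
have t0 : 0 < 1 + t ^+ 2 by rewrite ltr_wpDr ?sqr_ge0.
rewrite /psi expr_div_n ler_pdivrMr ?exprn_gt0//.
have := sqr_ge0 (t ^+ 2 - 1); nra.
Qed.

(** The remainder factors as [(x - y) ^ 2] times a bounded rational function.
    Differentiability, smoothness and strong convexity of the objective are all
    read off this inequality, so no second derivative is ever taken. *)
Lemma psi_taylor x y :
  `|psi x - psi y - dpsi y * (x - y)| <= 3 / 2 * (x - y) ^+ 2.
Proof.
have x0 : 0 < 1 + x ^+ 2 by rewrite ltr_wpDr ?sqr_ge0.
have y0 : 0 < 1 + y ^+ 2 by rewrite ltr_wpDr ?sqr_ge0.
have -> : psi x - psi y - dpsi y * (x - y) = (x - y) ^+ 2 *
    ((x * y ^+ 2 - 2 * y - x) / ((1 + x ^+ 2) * (1 + y ^+ 2) ^+ 2)).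
  by rewrite /psi /dpsi; field; rewrite !gt_eqF.
rewrite normrM (ger0_norm (sqr_ge0 _)) mulrC ler_wpM2r ?sqr_ge0//.
rewrite normf_div (gtr0_norm (mulr_gt0 x0 (exprn_gt0 _ y0))).
rewrite ler_pdivrMr ?mulr_gt0 ?exprn_gt0//.
have xx : `|x| <= (1 + x ^+ 2) / 2.
  have := sqr_ge0 (`|x| - 1); rewrite sqrrB1 real_normK ?num_real//; lra.
have yy : `|y| <= (1 + y ^+ 2) / 2.
  have := sqr_ge0 (`|y| - 1); rewrite sqrrB1 real_normK ?num_real//; lra.
have -> : x * y ^+ 2 - 2 * y - x = x * (y ^+ 2 - 1) - 2 * y by ring.
apply: (le_trans (ler_normB _ _)); rewrite !normrM (ger0_norm (ler0n _ _)).
have yb : `|y ^+ 2 - 1| <= 1 + y ^+ 2 by rewrite ler_norml; have := sqr_ge0 y; lra.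
have := sqr_ge0 x; have := sqr_ge0 y.
set a := x ^+ 2 in x0 xx *; set b := y ^+ 2 in y0 yy yb *.
set u := `|x| in xx *; set w := `|y| in yy *; set q := `|b - 1| in yb *.
move=> b0 a0.
have h1 : u * q <= (1 + a) / 2 * (1 + b).
  by apply: ler_pM; rewrite ?normr_ge0.
have h2 : (1 + a) * (1 + b) <= (1 + a) * (1 + b) ^+ 2.
  rewrite ler_wpM2l//; nra.
have h3 : 1 + b <= (1 + a) * (1 + b) ^+ 2 by nra.
lra.
Qed.

End Psi.

(** * One-dimensional wells, and differentiability from a Taylor bound *)

Definition sgnb {R : realFieldType} (b : bool) : R := if b then 1 else -1.

Lemma sgnb_sqr {R : realFieldType} b : sgnb b ^+ 2 = 1 :> R.
Proof. by case: b; rewrite /sgnb ?sqrrN expr1n. Qed.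

Lemma sgnbN {R : realFieldType} b : sgnb (~~ b) = - sgnb b :> R.
Proof. by case: b; rewrite /sgnb ?opprK. Qed.

Section WellFunction.
Context {R : realFieldType} (mu D : R).
Hypotheses (mu0 : 0 < mu) (D0 : 0 < D).

(** The coefficient [375 / 169] is half of [dpsi (1 / 5) / (1 / 5)], which makes
    [D / 5] or [- D / 5] a critical point. It also exceeds by more than [1 / 2]
    the constant [3 / 2] of [psi_taylor], which leaves [mu]-strong convexity. *)
Definition well (b : bool) (t : R) : R :=
  mu * (375 / 169 * t ^+ 2 - sgnb b * (D ^+ 2 * psi (t / D))).

Definition dwell (b : bool) (t : R) : R :=
  mu * (750 / 169 * t - sgnb b * (D * dpsi (t / D))).

Lemma well_taylor b x y :
  `|well b x - well b y - dwell b y * (x - y) - mu * (375 / 169) * (x - y) ^+ 2|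
    <= mu * (3 / 2) * (x - y) ^+ 2.
Proof.
have Dn : D != 0 by rewrite gt_eqF.
have -> : well b x - well b y - dwell b y * (x - y)
    - mu * (375 / 169) * (x - y) ^+ 2 = - (sgnb b * (mu * D ^+ 2 *
    (psi (x / D) - psi (y / D) - dpsi (y / D) * (x / D - y / D)))).
  by rewrite /well /dwell; field.
rewrite normrN normrM (_ : `|sgnb b| = 1) ?mul1r; last first.
  by case: b; rewrite /sgnb ?normrN normr1.
rewrite normrM gtr0_norm ?mulr_gt0 ?exprn_gt0//.
have -> : mu * (3 / 2) * (x - y) ^+ 2 =
    mu * D ^+ 2 * (3 / 2 * (x / D - y / D) ^+ 2) by field.
by rewrite ler_pM2l ?mulr_gt0 ?exprn_gt0// psi_taylor.
Qed.

(** Adding the Taylor bounds at [(x, y)] and [(y, x)] eliminates the values of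
    [well] and leaves [(dwell b x - dwell b y) * (x - y)]. *)
Lemma dwell_lipschitz b x y : `|dwell b x - dwell b y| <= mu * 8 * `|x - y|.
Proof.
have [->|xy] := eqVneq x y; first by rewrite !subrr !normr0 mulr0.
have xy0 : 0 < `|x - y| by rewrite normr_gt0 subr_eq0.
rewrite -(ler_pM2r xy0) -normrM.
rewrite -[X in _ <= X]mulrA -normrM -expr2 (ger0_norm (sqr_ge0 _)).
have := well_taylor b x y; have := well_taylor b y x.
have := sqr_ge0 (x - y); rewrite !ler_norml -(opprB x y) sqrrN.
set q := (x - y) ^+ 2; set p := mu * q => q0.
have : 0 <= p by rewrite mulr_ge0// ltW.
have -> : mu * 8 * q = 8 * p by rewrite /p; ring.
have -> : mu * (3 / 2) * q = 3 / 2 * p by rewrite /p; ring.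
have -> : mu * (375 / 169) * q = 375 / 169 * p by rewrite /p; ring.
move=> p0 /andP[a1 a2] /andP[b1 b2]; apply/andP; split; lra.
Qed.

Lemma dwell_min b : dwell b (sgnb b * (D / 5)) = 0.
Proof.
have Dn : D != 0 by rewrite gt_eqF.
rewrite /dwell /dpsi.
have -> : sgnb b * (D / 5) / D = sgnb b / 5 :> R by field.
by rewrite expr_div_n sgnb_sqr; field.
Qed.

End WellFunction.

Lemma enorm_sqr (R : realType) d (x : 'rV[R]_d) :
  enorm x ^+ 2 = \sum_(i < d) x ord0 i ^+ 2.
Proof.
rewrite /enorm sqr_sqrtr; first by apply: eq_bigr => i _; rewrite expr2.
by apply: sumr_ge0 => i _; rewrite -expr2 sqr_ge0.
Qed.

Lemma enorm_ge0 (R : realType) d (x : 'rV[R]_d) : 0 <= enorm x.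
Proof. exact: sqrtr_ge0. Qed.

Lemma enorm_le_coord (R : realType) d (x y : 'rV[R]_d) (L : R) : 0 <= L ->
  (forall i, `|x ord0 i| <= L * `|y ord0 i|) -> enorm x <= L * enorm y.
Proof.
move=> L0 xy; rewrite -(ler_sqr (x := enorm x)) ?nnegrE ?mulr_ge0 ?enorm_ge0//.
rewrite exprMn !enorm_sqr mulr_sumr ler_sum// => i _.
rewrite -(real_normK (num_real (x ord0 i))) -(real_normK (num_real (y ord0 i))).
by rewrite -exprMn lerXn2r ?nnegrE ?mulr_ge0.
Qed.

Lemma enorm_sqr_le_norm (R : realType) d (x : 'rV[R]_d) :
  enorm x ^+ 2 <= d%:R * `|x| ^+ 2.
Proof.
rewrite enorm_sqr (@le_trans _ _ (\sum_(i < d) `|x| ^+ 2))//; last first.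
  by rewrite sumr_const card_ord mulr_natl.
apply: ler_sum => i _; rewrite -(real_normK (num_real (x ord0 i))).
rewrite lerXn2r ?nnegrE//.
by rewrite {2}/Num.norm/= mx_normrE; apply: (le_bigmax _ (fun ij => `|x ij.1 ij.2|) (ord0, i)).
Qed.

(** A quadratic bound on the Taylor remainder with candidate gradient [G] makes
    [G] the gradient: the remainder is [o(h)] because the Euclidean norm is
    dominated by the sup norm. *)
Section GradientFromTaylor.
Context {R : realType} {d : nat} (f : 'rV[R]_d -> R^o) (G : 'rV[R]_d -> 'rV[R]_d).
Variable K : R.
Hypothesis fG : forall x y, `|f x - f y - dotv (G y) (x - y)| <= K * enorm (x - y) ^+ 2.

Let lin y (h : 'rV[R]_d) : R^o := dotv (G y) h.

Let lin_linear y : linear (lin y).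
Proof.
move=> a u w; rewrite /lin /dotv scaler_sumr -big_split/=.
by apply: eq_bigr => i _; rewrite !mxE mulrDr mulrCA.
Qed.

Let linL y : {linear 'rV[R]_d -> R^o} :=
  HB.pack (lin y) (GRing.isLinear.Build _ _ _ _ (lin y) (lin_linear y)).

Let lin_continuous y : continuous (linL y).
Proof.
have : continuous (fun h : 'rV[R]_d => \sum_(i < d) (G y ord0 i * h ord0 i) : R).
  move=> x; apply: (@cvg_big R^o 'I_d +%R 0 xpredT (@add_continuous R^o) _ _ _ _ _ (nbhs_filter x)) => i _.
  by apply: cvgM; [exact: cvg_cst | exact: coord_continuous].
exact.
Qed.

Let expansion y : f \o shift y = cst (f y) + linL y +o_ (0 : 'rV[R]_d) id.
Proof.
apply/eqaddoP => e e0.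
have KK : `|K| * d%:R + 1 > 0 by rewrite ltr_wpDl ?mulr_ge0.
near=> h => /=.
have -> : (f \o shift y - (cst (f y) + linL y)) h = f (h + y) - f y - dotv (G y) (h + y - y).
  by rewrite addrK /= /GRing.add /GRing.opp /= opprD addrA.
apply: (le_trans (fG _ _)); rewrite addrK.
apply: (@le_trans _ _ (`|K| * (d%:R * `|h| ^+ 2))).
  apply: (@le_trans _ _ (`|K| * enorm h ^+ 2)).
    by rewrite ler_wpM2r ?sqr_ge0 ?ler_norm.
  by rewrite ler_wpM2l ?enorm_sqr_le_norm.
rewrite mulrA expr2 mulrA ler_wpM2r//.
apply: (@le_trans _ _ ((`|K| * d%:R + 1) * `|h|)).
  by rewrite ler_wpM2r// lerDl.
rewrite -ler_pdivlMl//.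
near: h; have eK : 0 < (`|K| * d%:R + 1)^-1 * e by rewrite mulr_gt0 ?invr_gt0.
exact: (@nbhs0_le _ 'rV[R]_d _ eK).
Unshelve. all: by end_near. Qed.

Let diffE y : 'd f y = linL y :> ('rV[R]_d -> R^o).
Proof. by apply: diff_unique; [exact: lin_continuous | exact: expansion]. Qed.

Lemma differentiable_of_taylor y : differentiable f y.
Proof.
apply/diff_locallyP; rewrite diffE; split; first exact: lin_continuous.
exact: expansion.
Qed.

Lemma gradient_of_taylor y : gradient f y = G y.
Proof.
apply/rowP => i; rewrite mxE diffE /linL /= /lin /dotv (bigD1 i)//= mxE !eqxx/=.
rewrite mulr1 big1 ?addr0// => j ji.
by rewrite mxE eqxx/= (negbTE ji) mulr0.
Qed.

End GradientFromTaylor.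

(** * Weights of the paths of the sticky chain and their overlap *)

Lemma big_tuple_cons (V : nmodType) (S : finType) n (F : seq S -> V) :
  \sum_(s : n.+1.-tuple S) F s = \sum_(a : S) \sum_(t : n.-tuple S) F (a :: t).
Proof.
rewrite pair_bigA/=.
rewrite (reindex (fun q : S * n.-tuple S => [tuple of q.1 :: q.2]))//=.
exists (fun s : n.+1.-tuple S => (thead s, [tuple of behead s])).
  by move=> [a t] _ /=; congr pair; apply: val_inj.
by move=> s _; rewrite -tuple_eta.
Qed.

Lemma big_tuple_rcons (V : nmodType) (S : finType) n (F : seq S -> V) :
  \sum_(s : n.+1.-tuple S) F s = \sum_(t : n.-tuple S) \sum_(a : S) F (rcons t a).
Proof.
elim: n F => [|n IH] F.
  rewrite (big_tuple_cons _ F) exchange_big/=; apply: eq_bigr => t _.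
  by apply: eq_bigr => a _; rewrite tuple0.
rewrite (big_tuple_cons _ F) (big_tuple_cons _ (fun t => \sum_a F (rcons t a))).
by apply: eq_bigr => a _; rewrite (IH (fun s => F (a :: s))).
Qed.

(** The weights are defined for any [r], not only for probability vectors: for a
    lower bound [r] of the geometric mean of two laws they bound from below the
    Hellinger affinity of the two path laws. *)
Section PathWeight.
Context {R : realFieldType} {S : finType} (p : R).

Definition step_weight (r : S -> R) (a b : S) : R := (1 - p) * (a == b)%:R + p * r b.

Fixpoint walk_weight (r : S -> R) (a : S) (s : seq S) : R :=
  if s is b :: s' then step_weight r a b * walk_weight r b s' else 1.

Definition path_weight (r : S -> R) (s : seq S) : R :=
  if s is a :: s' then r a * walk_weight r a s' else 1.

Lemma sum_step_weight r a : \sum_b step_weight r a b = 1 - p + p * \sum_b r b.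
Proof.
rewrite big_split/= -!mulr_sumr; congr (_ + _).
rewrite (bigD1 a)//= eqxx big1 ?addr0 ?mulr1// => b ba.
by rewrite eq_sym (negbTE ba).
Qed.

Lemma walk_weight_rcons r a s b :
  walk_weight r a (rcons s b) = walk_weight r a s * step_weight r (last a s) b.
Proof. by elim: s a => [|c s IH] a /=; rewrite ?mulr1 ?mul1r// IH mulrA. Qed.

Lemma path_weight_rcons r s a b :
  path_weight r (rcons (rcons s a) b) = path_weight r (rcons s a) * step_weight r a b.
Proof.
by case: s => [|c s] /=; rewrite ?mulr1// !walk_weight_rcons last_rcons !mulrA.
Qed.

(** Consistency under adding a symbol in front, which is the stationarity of the
    chain. *)
Lemma path_weight_suml r s : \sum_a r a = 1 -> \sum_a path_weight r (a :: s) = path_weight r s.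
Proof.
move=> r1; case: s => [|b s] /=; first by rewrite -[RHS]r1; apply: eq_bigr => a _; rewrite mulr1.
under eq_bigr do rewrite mulrA.
rewrite -mulr_suml; congr (_ * _).
rewrite /step_weight; under eq_bigr do rewrite mulrDr.
rewrite big_split/= -mulr_suml r1 mul1r (bigD1 b)//= eqxx big1 => [|a /negbTE->].
  by rewrite mulr1 addr0; ring.
by rewrite !mulr0.
Qed.

(** Consistency under adding a symbol at the end, which lets the weights define a
    process. *)
Lemma path_weight_sumr r s : \sum_a r a = 1 -> \sum_a path_weight r (rcons s a) = path_weight r s.
Proof.
move=> r1; case/lastP: s => [|s b] /=.
  by rewrite -[RHS]r1; apply: eq_bigr => a _; rewrite mulr1.
under eq_bigr do rewrite path_weight_rcons.
by rewrite -mulr_sumr sum_step_weight r1 mulr1 subrK mulr1.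
Qed.

Lemma sum_walk_weight r a n :
  \sum_(s : n.-tuple S) walk_weight r a s = (1 - p + p * \sum_b r b) ^+ n.
Proof.
elim: n a => [|n IH] a.
  rewrite (bigD1 [tuple])//= big1 ?addr0 ?expr0// => s /negP[].
  exact/eqP/tuple0.
rewrite (big_tuple_cons _ (walk_weight r a)) exprS.
transitivity (\sum_b step_weight r a b * (1 - p + p * \sum_b r b) ^+ n).
  by apply: eq_bigr => b _; rewrite /= -mulr_sumr IH.
by rewrite -mulr_suml sum_step_weight.
Qed.

Lemma sum_path_weight r n :
  \sum_(s : n.+1.-tuple S) path_weight r s
    = (\sum_b r b) * (1 - p + p * \sum_b r b) ^+ n.
Proof.
rewrite (big_tuple_cons _ (path_weight r)) mulr_suml; apply: eq_bigr => a _.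
by rewrite /= -mulr_sumr sum_walk_weight.
Qed.

Hypothesis p01 : 0 <= p <= 1.

Lemma step_weight_ge0 r a b : (forall c, 0 <= r c) -> 0 <= step_weight r a b.
Proof.
move=> r0; case/andP: p01 => p0 p1.
by rewrite /step_weight addr_ge0 ?mulr_ge0 ?subr_ge0.
Qed.

Lemma walk_weight_ge0 r a s : (forall c, 0 <= r c) -> 0 <= walk_weight r a s.
Proof. by move=> r0; elim: s a => //= b s IH a; rewrite mulr_ge0 ?step_weight_ge0. Qed.

Lemma path_weight_ge0 r s : (forall c, 0 <= r c) -> 0 <= path_weight r s.
Proof. by move=> r0; case: s => //= a s; rewrite mulr_ge0 ?walk_weight_ge0. Qed.

Section Overlap.
Variables r q q' : S -> R.
Hypotheses (r0 : forall a, 0 <= r a) (q0 : forall a, 0 <= q a).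
Hypotheses (q'0 : forall a, 0 <= q' a) (rq : forall a, r a ^+ 2 <= q a * q' a).

(** Cauchy-Schwarz for the two terms of a step: the mass [(1 - p)] of staying is
    common to both laws and is kept entirely. *)
Lemma step_weight_overlap a b : step_weight r a b ^+ 2 <= step_weight q a b * step_weight q' a b.
Proof.
case/andP: p01 => p0 p1; rewrite /step_weight.
set c := (1 - p) * _.
have c0 : 0 <= c by rewrite mulr_ge0 ?subr_ge0.
have h : 2 * r b <= q b + q' b.
  rewrite -ler_sqr ?nnegrE ?mulr_ge0 ?addr_ge0//.
  have := rq b; have := sqr_ge0 (q b - q' b); nra.
have h1 : c * p * (2 * r b) <= c * p * (q b + q' b).
  apply: ler_wpM2l. exact: mulr_ge0. exact: h.
have h2 : p ^+ 2 * r b ^+ 2 <= p ^+ 2 * (q b * q' b).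
  by apply: ler_wpM2l; rewrite ?sqr_ge0.
nra.
Qed.

Lemma walk_weight_overlap a s : walk_weight r a s ^+ 2 <= walk_weight q a s * walk_weight q' a s.
Proof.
elim: s a => [|b s IH] a /=; first by rewrite expr1n mulr1.
by rewrite exprMn [leRHS]mulrACA; apply: ler_pM; rewrite ?sqr_ge0 ?step_weight_overlap.
Qed.

Lemma path_weight_overlap s : path_weight r s ^+ 2 <= path_weight q s * path_weight q' s.
Proof.
case: s => [|a s] /=; first by rewrite expr1n mulr1.
by rewrite exprMn [leRHS]mulrACA; apply: ler_pM; rewrite ?sqr_ge0 ?walk_weight_overlap.
Qed.

End Overlap.
End PathWeight.

(** An estimate [x] pays [w * w' / (w + w') * 4 * dl ^ 2] at least for guessing
    between [dl] and [- dl], and this is bounded from below linearly in the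
    overlap [g] by the inequality between the arithmetic and geometric means.
    Linearity is what allows summing over all paths. *)
Lemma two_point_sqr (R : realFieldType) (w w' g x dl : R) :
  0 <= w -> 0 <= w' -> g ^+ 2 <= w * w' ->
  4 * dl ^+ 2 * g - dl ^+ 2 * (w + w')
    <= w * (x - dl) ^+ 2 + w' * (x + dl) ^+ 2.
Proof.
move=> w0 w'0 gw.
have [W|W] := eqVneq (w + w') 0.
  have [-> ->] : w = 0 /\ w' = 0 by move: W; split; lra.
  have -> : g = 0.
    by apply/eqP; rewrite -sqrf_eq0 eq_le sqr_ge0 andbT (le_trans gw)//; nra.
  by rewrite !mul0r !addr0 !mulr0 subr0.
have Wp : 0 < w + w' by rewrite lt0r W addr_ge0.
rewrite -(ler_pM2l Wp).
have h1 := sqr_ge0 ((w + w') * x - (w - w') * dl).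
have h2 : 2 * (w + w') * g <= (w + w') ^+ 2 / 2 + 2 * g ^+ 2.
  by have := sqr_ge0 (w + w' - 2 * g); nra.
have h3 : dl ^+ 2 * (2 * (w + w') * g) <= dl ^+ 2 * ((w + w') ^+ 2 / 2 + 2 * g ^+ 2).
  by rewrite ler_wpM2l ?sqr_ge0.
have h4 : dl ^+ 2 * g ^+ 2 <= dl ^+ 2 * (w * w') by rewrite ler_wpM2l ?sqr_ge0.
rewrite -subr_ge0.
have -> : (w + w') * (w * (x - dl) ^+ 2 + w' * (x + dl) ^+ 2) -
  (w + w') * (4 * dl ^+ 2 * g - dl ^+ 2 * (w + w')) =
  ((w + w') * x - (w - w') * dl) ^+ 2 + 4 * (dl ^+ 2 * (w * w'))
  - 2 * (dl ^+ 2 * (2 * (w + w') * g)) + dl ^+ 2 * (w + w') ^+ 2 by ring.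
have -> : dl ^+ 2 * (w + w') ^+ 2 = 2 * (dl ^+ 2 * ((w + w') ^+ 2 / 2 + 2 * g ^+ 2)) - 4 * (dl ^+ 2 * g ^+ 2) by field.
lra.
Qed.

(** * Biased signs and the averaging over sign vectors *)

Section SignProduct.
Context {R : realFieldType} {d : nat}.
Local Notation cube := {ffun 'I_d -> bool}.
Implicit Types v z : cube.

Lemma sum_cube_prod (phi : 'I_d -> bool -> R) :
  \sum_(z : cube) \prod_i phi i (z i) = \prod_i (phi i true + phi i false).
Proof.
rewrite -(bigA_distr_bigA phi); apply: eq_bigr => i _.
by rewrite big_bool.
Qed.

Variable eps : R.

Definition coin (b c : bool) : R := (1 + eps * sgnb b * sgnb c) / 2.

Definition coins v z : R := \prod_i coin (v i) (z i).

Lemma coins_mean (phi : 'I_d -> bool -> R) v :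
  \sum_z coins v z * \prod_i phi i (z i)
    = \prod_i (coin (v i) true * phi i true + coin (v i) false * phi i false).
Proof.
rewrite -(sum_cube_prod (fun i c => coin (v i) c * phi i c)).
by apply: eq_bigr => z _; rewrite -big_split.
Qed.

Lemma sum_coins v : \sum_z coins v z = 1.
Proof.
rewrite /coins (sum_cube_prod (fun i => coin (v i))) big1// => i _.
by rewrite /coin /sgnb; case: (v i); field.
Qed.

(** The coordinates are independent, so the covariance of two distinct ones
    factors into a product containing a vanishing mean. *)
Lemma coins_cov v i j :
  \sum_z coins v z * ((sgnb (z i) - eps * sgnb (v i)) *
                      (sgnb (z j) - eps * sgnb (v j)))
    = (1 - eps ^+ 2) *+ (i == j).
Proof.
(* The two factors at [i] and [j] as one product over all coordinates. *)
pose phi k c := (if k == i then sgnb c - eps * sgnb (v i) else 1) *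
                (if k == j then sgnb c - eps * sgnb (v j) else 1) : R.
transitivity (\sum_z coins v z * \prod_k phi k (z k)).
  apply: eq_bigr => z _; congr (_ * _).
  rewrite /phi big_split/= -!big_mkcond/=; congr (_ * _).
    by rewrite big_pred1_eq.
  by rewrite big_pred1_eq.
rewrite coins_mean (bigD1 i)//= /phi eqxx.
have [->|ij] := eqVneq i j.
  rewrite big1 ?mulr1 => [|k /negbTE ->].
    by rewrite /coin /sgnb; case: (v j); rewrite mulr1n; field.
  by rewrite /coin /sgnb; case: (v k); field.
apply/eqP; rewrite mulr0n mulf_eq0; apply/orP; left; apply/eqP.
by rewrite /coin /sgnb; case: (v i); field.
Qed.

Lemma coins_mean_sgn v j : \sum_z coins v z * sgnb (z j) = eps * sgnb (v j).
Proof.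
pose phi k c := (if k == j then sgnb c else 1) : R.
transitivity (\sum_z coins v z * \prod_k phi k (z k)).
  by apply: eq_bigr => z _; rewrite /phi -big_mkcond big_pred1_eq.
rewrite coins_mean (bigD1 j)//= /phi eqxx big1 ?mulr1 => [|k /negbTE ->].
  by rewrite /coin /sgnb; case: (v j); field.
by rewrite /coin /sgnb; case: (v k); field.
Qed.

(** Pairwise uncorrelated noise terms add in squares. This is where the dimension
    enters the final rate as [sqrt d]. *)
Lemma coins_variance v (a : 'I_d -> R) :
  \sum_z coins v z * (\sum_j a j * (sgnb (z j) - eps * sgnb (v j))) ^+ 2
    = (1 - eps ^+ 2) * \sum_j a j ^+ 2.
Proof.
transitivity (\sum_i \sum_j a i * a j * ((1 - eps ^+ 2) *+ (i == j))).
  under eq_bigr => z _.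
    rewrite expr2 mulr_suml mulr_sumr.
    under eq_bigr do rewrite mulr_sumr mulr_sumr.
    over.
  rewrite exchange_big/=; apply: eq_bigr => i _.
  rewrite exchange_big/=; apply: eq_bigr => j _.
  rewrite -(coins_cov v) mulr_sumr; apply: eq_bigr => z _; ring.
rewrite mulr_sumr; apply: eq_bigr => i _.
rewrite (bigD1 i)//= eqxx big1 ?addr0 => [|j /negbTE ji].
  by rewrite mulr1n; ring.
by rewrite eq_sym ji mulr0n mulr0.
Qed.

Definition flip j v : cube := [ffun i => if i == j then ~~ v i else v i].

Lemma flipK j : involutive (flip j).
Proof. by move=> v; apply/ffunP => i; rewrite !ffunE; case: eqP; rewrite ?negbK. Qed.

Hypothesis eps01 : 0 <= eps <= 1.

Lemma coin_ge0 b c : 0 <= coin b c.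
Proof.
case/andP: eps01 => e0 e1; rewrite /coin /sgnb.
by case: b; case: c; rewrite divr_ge0//; lra.
Qed.

Lemma coins_ge0 v z : 0 <= coins v z.
Proof. by apply: prodr_ge0 => i _; exact: coin_ge0. Qed.

(** A lower bound of the geometric mean of [coins v] and [coins (flip j v)]: the
    two agree off [j], and at [j] the exact value [sqrt (1 - eps ^ 2) / 2] is
    replaced by the smaller [(1 - eps ^ 2) / 2] to avoid square roots. *)
Definition overlap j v z : R :=
  \prod_i (if i == j then (1 - eps ^+ 2) / 2 else coin (v i) (z i)).

Lemma overlap_coin_ge0 : 0 <= (1 - eps ^+ 2) / 2.
Proof. case/andP: eps01 => e0 e1; nra. Qed.

Lemma overlap_ge0 j v z : 0 <= overlap j v z.
Proof.
by apply: prodr_ge0 => i _; case: eqP => _; rewrite ?coin_ge0 ?overlap_coin_ge0.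
Qed.

Lemma overlap_sqr j v z :
  overlap j v z ^+ 2 <= coins v z * coins (flip j v) z.
Proof.
rewrite -prodrXl -big_split/=; apply: ler_prod => i _.
rewrite sqr_ge0/= ffunE; case: eqP => // _.
rewrite /coin sgnbN.
have : sgnb (v i) * sgnb (z i) = 1 :> R \/ sgnb (v i) * sgnb (z i) = -1 :> R.
  by rewrite /sgnb; case: (v i); case: (z i); rewrite ?mulrNN !(mul1r, mulr1, mulN1r); auto.
rewrite mulrN mulNr -mulrA; case/andP: eps01 => e0 e1.
have : 0 <= eps ^+ 2 <= 1 by rewrite sqr_ge0 expr_le1.
by move=> /andP[? ?] [] ->; nra.
Qed.

Lemma sum_overlap j v : \sum_z overlap j v z = 1 - eps ^+ 2.
Proof.
rewrite (sum_cube_prod (fun i c => if i == j then (1 - eps ^+ 2) / 2 else coin (v i) c)).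
rewrite (bigD1 j)//= eqxx big1 ?mulr1 => [|k /negbTE ->]; first by field.
by rewrite /coin /sgnb; case: (v k); field.
Qed.

End SignProduct.

Section Assouad.
Context {R : realFieldType} {d : nat} (p eps dl : R) (n : nat).
Local Notation cube := {ffun 'I_d -> bool}.
Hypothesis p01 : 0 <= p <= 1.
Hypothesis eps01 : 0 <= eps <= 1.
Hypothesis info : eps ^+ 2 * (1 + n%:R * p) <= 1 / 4.

(** The total is [(1 - eps ^ 2) * (1 - p * eps ^ 2) ^ n], and Bernoulli's
    inequality bounds it from below by [1] minus [eps ^ 2] times the expected
    number [1 + n * p] of draws. *)
Lemma overlap_mass j (v : cube) :
  3 / 4 <= \sum_(s : n.+1.-tuple cube) path_weight p (overlap eps j v) s.
Proof.
rewrite (sum_path_weight p (overlap eps j v)) sum_overlap.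
case/andP: p01 => p0 p1; case/andP: eps01 => e0 e1.
have e2 : 0 <= eps ^+ 2 <= 1 by rewrite sqr_ge0 expr_le1.
have -> : 1 - p + p * (1 - eps ^+ 2) = 1 - p * eps ^+ 2 by ring.
have := info; set q := eps ^+ 2 in e2 * => info'; case/andP: e2 => q0 q1.
have bern k : 1 - k%:R * (p * q) <= (1 - p * q) ^+ k.
  elim: k => [|k IH]; first by rewrite mul0r subr0 expr0.
  have pq1 : 0 <= 1 - p * q by nra.
  rewrite exprS; apply: (@le_trans _ _ ((1 - p * q) * (1 - k%:R * (p * q)))).
    rewrite -natr1 mulrDl mul1r -subr_ge0.
    have -> : (1 - p * q) * (1 - k%:R * (p * q)) - (1 - (k%:R * (p * q) + p * q))
      = k%:R * (p * q) ^+ 2 by ring.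
    by rewrite mulr_ge0 ?sqr_ge0.
  exact: ler_wpM2l.
apply: (@le_trans _ _ ((1 - q) * (1 - n%:R * (p * q)))); last first.
  by apply: ler_wpM2l; [rewrite subr_ge0 | exact: bern].
have -> : (1 - q) * (1 - n%:R * (p * q)) = 1 - q * (1 + n%:R * p) + n%:R * p * q ^+ 2 by ring.
have : 0 <= n%:R * p * q ^+ 2 by rewrite !mulr_ge0 ?sqr_ge0.
lra.
Qed.

(** For each coordinate [j], pair [v] with [flip j v]: their path laws overlap, so
    the two errors in coordinate [j] add up to at least [dl ^ 2]. *)
Lemma assouad (x : n.+1.-tuple cube -> 'I_d -> R) :
  #|{: cube}|%:R * (d%:R * dl ^+ 2 / 2) <=
  \sum_(v : cube) \sum_(s : n.+1.-tuple cube) path_weight p (coins eps v) s *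
     \sum_j (x s j - sgnb (v j) * dl) ^+ 2.
Proof.
pose A j v := \sum_(s : n.+1.-tuple cube) path_weight p (coins eps v) s *
    (x s j - sgnb (v j) * dl) ^+ 2.
have -> : \sum_(v : cube) \sum_(s : n.+1.-tuple cube) path_weight p (coins eps v) s *
     \sum_j (x s j - sgnb (v j) * dl) ^+ 2 = \sum_j \sum_v A j v.
  rewrite [RHS]exchange_big/=; apply: eq_bigr => v _.
  rewrite [RHS]exchange_big/=; apply: eq_bigr => s _.
  by rewrite mulr_sumr.
have pair j v : dl ^+ 2 <= A j v + A j (flip j v).
  rewrite /A -big_split/=.
  pose W v := \sum_(s : n.+1.-tuple cube) path_weight p (coins eps v) s.
  have W1 u : W u = 1.
    by rewrite /W sum_path_weight sum_coins mulr1 subrK expr1n mulr1.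
  apply: (@le_trans _ _ (\sum_(s : n.+1.-tuple cube)
     (4 * dl ^+ 2 * path_weight p (overlap eps j v) s - dl ^+ 2 *
       (path_weight p (coins eps v) s + path_weight p (coins eps (flip j v)) s)))).
    rewrite sumrB -!mulr_sumr big_split/= -/(W v) -/(W (flip j v)) !W1.
    have := overlap_mass j v; have := sqr_ge0 dl; nra.
  apply: ler_sum => s _.
  have c0 (u z : cube) : 0 <= coins eps u z := coins_ge0 eps01 u z.
  have w0 := path_weight_ge0 p01 s (c0 v); have w0' := path_weight_ge0 p01 s (c0 (flip j v)).
  have ov : path_weight p (overlap eps j v) s ^+ 2 <=
      path_weight p (coins eps v) s * path_weight p (coins eps (flip j v)) s.
    apply: path_weight_overlap => // a; [exact: overlap_ge0|exact: overlap_sqr].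
  rewrite ffunE eqxx; case: (v j); rewrite /sgnb/= mulN1r mul1r opprK.
    exact: two_point_sqr.
  rewrite (addrC (path_weight p (coins eps v) s)) [leRHS]addrC.
  by apply: two_point_sqr => //; rewrite mulrC.
have half j : #|{: cube}|%:R * dl ^+ 2 <= 2 * \sum_v A j v.
  rewrite mulr_natl mulrDl mul1r [X in _ + X](reindex_inj (inv_inj (flipK j))).
  rewrite -big_split/= -sumr_const; apply: ler_sum => v _; exact: pair.
rewrite mulrC -mulrA -(@ler_pM2l _ 2)// mulr_sumr.
apply: (@le_trans _ _ (\sum_(j < d) #|{: cube}|%:R * dl ^+ 2)); last exact: ler_sum.
by rewrite sumr_const card_ord -mulr_natr le_eqVlt; apply/orP; left; apply/eqP; field.
Qed.

End Assouad.

(** * Processes with prescribed finite-dimensional laws *)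

Section Cumulative.
Context {R : realFieldType} {S : finType} (u : S -> R).
Hypothesis u0 : forall a, 0 <= u a.

(** Left endpoints for laying intervals of lengths [u a] end to end, in the order
    of the enumeration of [S]. *)
Definition below (a : S) : R := \sum_(b | (enum_rank b < enum_rank a)%N) u b.

Lemma below_ge0 a : 0 <= below a.
Proof. exact: sumr_ge0. Qed.

Lemma below_lt a b : (enum_rank a < enum_rank b)%N -> below a + u a <= below b.
Proof.
move=> ab; rewrite /below [leRHS](bigD1 a)//= [leLHS]addrC lerD2l.
rewrite [leRHS]big_mkcond [leLHS]big_mkcond/=; apply: ler_sum => c _.
case: ifPn => ca; last by case: ifP.
rewrite (ltn_trans ca ab)/=; case: eqVneq => // cE.
by rewrite cE ltnn in ca.
Qed.

Lemma below_le_total a : below a + u a <= \sum_b u b.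
Proof.
rewrite /below [leRHS](bigD1 a)//= [leLHS]addrC lerD2l.
rewrite [leRHS]big_mkcond [leLHS]big_mkcond/=; apply: ler_sum => c _.
case: ifPn => ca; last by case: ifP.
by case: eqVneq => // cE; rewrite cE ltnn in ca.
Qed.

Lemma below_exists x : 0 <= x < \sum_b u b ->
  exists a, below a <= x < below a + u a.
Proof.
move=> /andP[x0 xu].
pose c k := \sum_(b | (enum_rank b < k)%N) u b.
have [|k xk kmin] := @ex_minnP (fun k => x < c k).
  exists #|S|; rewrite /c (eq_bigl xpredT)// => b; exact: ltn_ord.
case: k xk kmin => [|k] xk kmin.
  by move: xk; rewrite /c big_pred0// ltNge x0.
have kS : (k < #|S|)%N.
  rewrite ltnNge; apply/negP => Sk.
  suff /kmin : x < c k by rewrite ltnn.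
  rewrite /c (eq_bigl xpredT)// => b; exact: leq_trans (ltn_ord _) Sk.
pose a := enum_val (Ordinal kS).
have ra : enum_rank a = k :> nat by rewrite /a enum_valK.
exists a; apply/andP; split.
  rewrite leNgt; apply/negP => h.
  suff /kmin : x < c k by rewrite ltnn.
  by move: h; rewrite /below ra.
have -> : below a + u a = c k.+1; last by [].
rewrite /c (bigD1 a)/= ?ra// addrC; congr (_ + _); apply: eq_bigl => b.
rewrite ra ltnS ltn_neqAle andbC; congr (_ && _).
by rewrite -ra (inj_eq val_inj) (inj_eq enum_rank_inj).
Qed.

End Cumulative.

Section Cylinder.
Context {R : realType} {S : finType} (s0 : S) (w : seq S -> R).
Hypothesis w_ge0 : forall s, 0 <= w s.
Hypothesis w_nil : w [::] = 1.
Hypothesis w_sumr : forall s, \sum_a w (rcons s a) = w s.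

Let u (s : seq S) (a : S) : R := w (rcons s a).

Let u_ge0 s a : 0 <= u s a. Proof. exact: w_ge0. Qed.

Fixpoint cyl_left_from (pre : seq S) (s : seq S) : R :=
  if s is a :: s' then below (u pre) a + cyl_left_from (rcons pre a) s' else 0.

Definition cyl_left (s : seq S) : R := cyl_left_from [::] s.

Lemma cyl_left_rcons s a : cyl_left (rcons s a) = cyl_left s + below (u s) a.
Proof.
rewrite /cyl_left -[s in u s]/([::] ++ s).
elim: s [::] => [|b s IH] pre /=; first by rewrite cats0 addr0 add0r.
by rewrite IH addrA cat_rcons.
Qed.

(** The half-open interval of a word; the intervals of its one-letter extensions
    partition it. *)
Definition in_cyl (s : seq S) (x : R) : bool := cyl_left s <= x < cyl_left s + w s.

Lemma in_cyl_nil x : in_cyl [::] x = (0 <= x < 1).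
Proof. by rewrite /in_cyl /cyl_left/= w_nil add0r. Qed.

Lemma in_cyl_rcons s a x : in_cyl (rcons s a) x -> in_cyl s x.
Proof.
rewrite /in_cyl cyl_left_rcons => /andP[h1 h2].
have := below_le_total (u_ge0 s) a; have := below_ge0 (u_ge0 s) a.
rewrite /= w_sumr -/(u s) /u => h3 h4.
apply/andP; split; first by rewrite (le_trans _ h1)// lerDl.
by rewrite (lt_le_trans h2)// -addrA lerD2l.
Qed.

Lemma in_cyl_next s x : in_cyl s x -> exists a, in_cyl (rcons s a) x.
Proof.
move=> /andP[h1 h2].
have [|a /andP[ha hb]] := @below_exists _ _ (u s) (x - cyl_left s).
  by rewrite w_sumr subr_ge0 h1 ltrBlDl.
exists a; rewrite /in_cyl cyl_left_rcons.
by rewrite -lerBrDl ha -addrA -ltrBlDl hb.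
Qed.

Lemma in_cyl_inj s a b x :
  in_cyl (rcons s a) x -> in_cyl (rcons s b) x -> a = b.
Proof.
have key c e : (enum_rank c < enum_rank e)%N -> in_cyl (rcons s c) x ->
    in_cyl (rcons s e) x -> False.
  move=> ce /andP[_ h1] /andP[h2 _].
  have := below_lt (u_ge0 s) ce; rewrite /= -/(u s).
  move: h1 h2; rewrite !cyl_left_rcons /u; lra.
move=> ha hb; have [||/val_inj/enum_rank_inj//] := ltngtP (enum_rank a) (enum_rank b).
  by move/key => /(_ ha hb).
by move/key => /(_ hb ha).
Qed.

(** The default symbol is reached only for [x] outside [[0, 1)], a null set for
    [uniform01]. *)
Definition next_symbol (s : seq S) (x : R) : S :=
  odflt s0 [pick a | in_cyl (rcons s a) x].

Fixpoint path_of (n : nat) (x : R) : seq S :=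
  if n is n'.+1 then rcons (path_of n' x) (next_symbol (path_of n' x) x)
  else [::].

Definition symbol (n : nat) (x : R) : S := next_symbol (path_of n x) x.

Lemma path_ofE n x : path_of n x = mkseq (fun i => symbol i x) n.
Proof. by elim: n => //= n IH; rewrite mkseqS -IH. Qed.

Lemma path_of_cyl s x : 0 <= x < 1 -> (path_of (size s) x = s) <-> in_cyl s x.
Proof.
move=> x01; elim/last_ind: s => [|s a IH]; first by rewrite in_cyl_nil x01.
rewrite size_rcons/=; split.
  move=> /rcons_inj[ps na]; move: na; rewrite ps /next_symbol.
  case: pickP => [b hb /= <-//|no _].
  by have [c] := in_cyl_next (IH.1 ps); rewrite no.
move=> ha; have ps := IH.2 (in_cyl_rcons ha); rewrite ps /next_symbol.
case: pickP => [b hb /=|/(_ a)]; last by rewrite ha.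
by rewrite (in_cyl_inj ha hb).
Qed.

Lemma in_cyl01 s x : in_cyl s x -> 0 <= x < 1.
Proof.
by elim/last_ind: s => [|s a IH]; [rewrite in_cyl_nil | move/in_cyl_rcons].
Qed.

(** Needed for the measurability of path events on the whole line. *)
Lemma path_of_out n x : ~~ (0 <= x < 1) -> path_of n x = nseq n s0.
Proof.
move=> x01; elim: n => //= n ->; rewrite -[RHS]/(nseq n.+1 s0) -addn1 nseqD cats1.
congr rcons; rewrite /next_symbol; case: pickP => //= a /in_cyl01.
by rewrite (negbTE x01).
Qed.

Let mu := @lebesgue_measure R.
Let unit_itv : set (measurableTypeR R) := `[0, 1[%classic.
Let munit : measurable unit_itv. Proof. exact: measurable_itv. Qed.

Definition uniform01 : set (measurableTypeR R) -> \bar R := mrestr mu munit.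
HB.instance Definition _ := Measure.on uniform01.

Let uniform01T : uniform01 setT = 1%E.
Proof. by rewrite /uniform01 /mrestr setTI /mu lebesgue_measure_itv/= lte_fin ltr01 oppr0 adde0. Qed.

HB.instance Definition _ := Measure_isProbability.Build _ _ _ uniform01 uniform01T.

Let cyl_set (s : seq S) := [set x : R | in_cyl s x].

Let cyl_setE s : cyl_set s = `[cyl_left s, cyl_left s + w s[%classic.
Proof. by apply/seteqP; split => x; rewrite /cyl_set/= in_itv. Qed.

Let path_setE s : [set x | path_of (size s) x = s] =
  cyl_set s `|` (if s == nseq (size s) s0 then ~` unit_itv else set0).
Proof.
apply/seteqP; split => x /=.
  have [x01|x01] := boolP (0 <= x < 1); first by move/(path_of_cyl _ x01); left.
  rewrite path_of_out// => <-; right; rewrite size_nseq eqxx /unit_itv/= in_itv/=.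
  exact/negP.
case=> [h|]; first exact/(path_of_cyl _ (in_cyl01 h)).
case: eqP => // -> h; rewrite size_nseq path_of_out//.
by apply/negP => x01; apply: h; rewrite /unit_itv/= in_itv.
Qed.

Lemma measurable_path_of s :
  measurable ([set x | path_of (size s) x = s] : set (measurableTypeR R)).
Proof.
rewrite path_setE cyl_setE; apply: measurableU; first exact: measurable_itv.
by case: ifP => _ //; apply: measurableC.
Qed.

Lemma uniform01_path_of s : uniform01 [set x | path_of (size s) x = s] = (w s)%:E.
Proof.
rewrite /uniform01 /mrestr.
have -> : [set x | path_of (size s) x = s] `&` unit_itv = cyl_set s.
  apply/seteqP; split => x /=.
    rewrite /unit_itv/= in_itv/= => -[p x01]; exact/(path_of_cyl _ x01).
  by move=> h; rewrite /unit_itv/= in_itv/= (in_cyl01 h); split=> //; apply/(path_of_cyl _ (in_cyl01 h)).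
rewrite cyl_setE /mu lebesgue_measure_itv/= lte_fin ltrDl.
have [wp|] := ltP 0 (w s); first by rewrite -EFinD addrAC subrr add0r.
by move=> h; congr EFin; apply/eqP; rewrite eq_le h w_ge0.
Qed.

End Cylinder.

(** Nested intervals replace Kolmogorov's extension theorem: over a finite
    alphabet, consistent weights of words are the lengths of nested intervals, and
    reading off the intervals that contain a uniform point yields the process. *)
Lemma exists_process (R : realType) (S : finType) (s0 : S) (w : seq S -> R) :
  (forall s, 0 <= w s) -> w [::] = 1 ->
  (forall s, \sum_a w (rcons s a) = w s) ->
  exists (P : probability (measurableTypeR R) R) (Y : nat -> R -> S),
    forall s : seq S,
      measurable ([set x | mkseq (Y^~ x) (size s) = s] : set (measurableTypeR R)) /\
      P [set x | mkseq (Y^~ x) (size s) = s] = (w s)%:E.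
Proof.
move=> w_ge0 w_nil w_sumr; exists (@uniform01 R), (symbol s0 w) => s.
have -> : [set x | mkseq (symbol s0 w ^~ x) (size s) = s] =
          [set x | path_of s0 w (size s) x = s].
  by apply/seteqP; split => x /=; rewrite path_ofE.
by split; [exact: measurable_path_of | exact: uniform01_path_of].
Qed.

(** * Integrals and events that depend on finitely many steps *)

Section SymbolProcess.
Context {R : realType} {dO : measure_display} {Omega : measurableType dO}.
Context (P : probability Omega R) {S : finType} (Y : nat -> Omega -> S).
Context (w : seq S -> R).

Definition path_at (n : nat) (x : Omega) : seq S := mkseq (Y^~ x) n.

Hypothesis law : forall s : seq S,
  measurable [set x | path_at (size s) x = s] /\
  P [set x | path_at (size s) x = s] = (w s)%:E.

Let cyl n (t : n.-tuple S) : set Omega := [set x | path_at n x = t].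

Let measurable_cyl n (t : n.-tuple S) : measurable (cyl t).
Proof. by have [] := law t; rewrite size_tuple. Qed.

Let P_cyl n (t : n.-tuple S) : P (cyl t) = (w t)%:E.
Proof. by have [_] := law t; rewrite size_tuple. Qed.

(** A function of the first [n] symbols is a finite combination of indicators of
    cylinders, which reduces all integrals below to finite sums. *)
Lemma path_at_sum n (G : seq S -> R) x :
  G (path_at n x) = \sum_(t : n.-tuple S) G t * \1_(cyl t) x.
Proof.
have sz : size (path_at n x) == n by rewrite size_mkseq.
rewrite (bigD1 (Tuple sz))//= indicE mem_set// mulr1 big1 ?addr0// => t tx.
rewrite indicE memNset ?mulr0// => xt; move/negP: tx; apply.
by apply/eqP/val_inj.
Qed.

Let integrable_term n (G : seq S -> R) (t : n.-tuple S) :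
  P.-integrable setT (fun x => ((G t)%:E * (\1_(cyl t) x)%:E)%E).
Proof. by apply: integrableZl => //; exact: integrable_indic. Qed.

Let path_at_sumE n (G : seq S -> R) :
  (fun x => (G (path_at n x))%:E) =
  (fun x => \sum_(t : n.-tuple S) ((G t)%:E * (\1_(cyl t) x)%:E))%E.
Proof.
apply/funext => x; rewrite path_at_sum -sumEFin.
by apply: eq_bigr => t _; rewrite EFinM.
Qed.

Lemma integrable_path_at n (G : seq S -> R) :
  P.-integrable setT (fun x => (G (path_at n x))%:E).
Proof.
by rewrite path_at_sumE; apply: integrable_sum => // t _; exact: integrable_term.
Qed.

Lemma integral_path_at n (G : seq S -> R) :
  (\int[P]_x (G (path_at n x))%:E = (\sum_(t : n.-tuple S) w t * G t)%:E)%E.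
Proof.
rewrite path_at_sumE integral_sum// -sumEFin; apply: eq_bigr => t _.
rewrite integralZl//; last exact: integrable_indic.
rewrite integral_indic// setIT. by rewrite [X in (_ * X)%E](P_cyl t) -EFinM mulrC.
Qed.

Lemma measurable_path_event n (E : set (seq S)) :
  measurable [set x | E (path_at n x)].
Proof.
have -> : [set x | E (path_at n x)] =
    \bigcup_(t in [set t : n.-tuple S | E t]) cyl t.
  apply/seteqP; split => x /=.
    move=> Ex; have sz : size (path_at n x) == n by rewrite size_mkseq.
    by exists (Tuple sz).
  by move=> [t Et xt]; rewrite xt.
by apply: fin_bigcup_measurable => // t _; exact: measurable_cyl.
Qed.

Lemma P_path_event n (E : set (seq S)) :
  P [set x | E (path_at n x)] = (\sum_(t : n.-tuple S) w t * (`[< E t >])%:R)%:E.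
Proof.
rewrite -(integral_path_at n (fun s => (`[< E s >])%:R)).
have mE := measurable_path_event n E.
by rewrite -[in LHS](setIT [set x | E (path_at n x)]) -integral_indic.
Qed.

Lemma integral_path_event n (E : set (seq S)) (G : seq S -> R) :
  (\int[P]_(x in [set x | E (path_at n x)]) (G (path_at n x))%:E =
   (\sum_(t : n.-tuple S) w t * (`[< E t >]%:R * G t))%:E)%E.
Proof.
rewrite -(integral_path_at n (fun s => `[< E s >]%:R * G s)).
rewrite integral_mkcond; apply: eq_integral => x _; rewrite patchE.
case: ifPn => [/set_mem/= h|]; first by rewrite (asboolT h) mul1r.
by rewrite notin_setE/= => h; rewrite (asboolF h) mul0r.
Qed.

(* The finite-alphabet process is carried into a measurable space by [code]. *)
Context {dT : measure_display} {T : measurableType dT} (code : S -> T).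

Lemma measurable_code_symbol n : measurable_fun setT (fun x => code (Y n x)).
Proof.
move=> _ A mA; rewrite setTI.
rewrite (_ : _ @^-1` A = [set x | [set s | exists r a, s = rcons r a /\ A (code a)]
    (path_at n.+1 x)]); first exact: measurable_path_event.
apply/seteqP; split => x; rewrite /path_at/= mkseqS.
  by move=> Ax; exists (mkseq (Y^~ x) n), (Y n x).
by move=> [r [a [/rcons_inj[_ ->]]]].
Qed.

Definition code_chain (n : nat) : {RV P >-> T} :=
  HB.pack (fun x => code (Y n x))
    (isMeasurableFun.Build _ _ _ _ (fun x => code (Y n x)) (measurable_code_symbol n)).

(** The events that do not separate points with the same first symbols form a
    sigma-algebra, and it contains the generators of the filtration. *)
Lemma natural_filtration_path n (B : set Omega) :
  natural_filtration (fun k => code_chain k : Omega -> T) n B ->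
  exists E : set (seq S), B = [set x | E (path_at n.+1 x)].
Proof.
move=> BF; suff sat : forall x y, path_at n.+1 x = path_at n.+1 y -> B x -> B y.
  exists [set s | exists2 x, B x & path_at n.+1 x = s].
  apply/seteqP; split => [x Bx|x [y By yx]] /=; first by exists x.
  exact: sat yx By.
suff : natural_filtration (fun k => code_chain k : Omega -> T) n `<=`
    [set B | forall x y, path_at n.+1 x = path_at n.+1 y -> B x <-> B y].
  by move/(_ _ BF) => /= h x y /h[].
apply: smallest_sub.
  split=> [x y //|A hA x y xy|F hF x y xy]/=.
    by split=> -[_ nA]; split=> //; apply: contra_not nA; case: (hA _ _ xy).
  by split=> -[k _ Fk]; exists k => //; case: (hF k _ _ xy); auto.
move=> C [i /= i_n [A mA <-]] x y xy; rewrite !setTI /= /preimage /=.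
suff -> : Y i x = Y i y by [].
have := congr1 (fun s => nth (Y i x) s i) xy.
by rewrite /path_at !nth_mkseq// ltnS.
Qed.

End SymbolProcess.

(** * The sticky kernel *)

Section StickyKernel.
Context {d : measure_display} {T : measurableType d} {R : realType}.
Context (m : probability T R) (p : R).

(** The proof that [p] is a probability is an argument, so that the instance of a
    probability kernel can be inferred. *)
Definition sticky (p01 : 0 <= p <= 1) (z : T) : {measure set T -> \bar R} :=
  measure_add
    (mscale (NngNum (etrans (subr_ge0 _ _) (proj2 (andP p01)))) (dirac z))
    (mscale (NngNum (proj1 (andP p01))) m).

Hypothesis p01 : 0 <= p <= 1.

Lemma stickyE z A :
  sticky p01 z A = ((1 - p)%:E * (\1_A z)%:E + p%:E * m A)%E.
Proof. exact: measure_addE. Qed.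

Let measurable_sticky U : measurable U -> measurable_fun [set: T] (sticky p01 ^~ U : T -> \bar R).
Proof.
move=> mU; rewrite (_ : sticky p01 ^~ U = fun z => ((1 - p)%:E * (\1_U z)%:E + p%:E * m U)%E);
  last by apply/funext => z; rewrite stickyE.
apply: emeasurable_funD => //; apply: measurable_funeM.
by apply/measurable_EFinP; exact: measurable_indic.
Qed.

HB.instance Definition _ := isKernel.Build _ _ _ _ _ (sticky p01) measurable_sticky.

Let sticky_prob z : sticky p01 z setT = 1%E.
Proof.
by rewrite stickyE indicT probability_setT !mule1 -EFinD subrK.
Qed.

HB.instance Definition _ :=
  Kernel_isProbability.Build _ _ _ _ _ (sticky p01) sticky_prob.

Lemma integral_indic_cst (mu : {measure set T -> \bar R}) A (a b : R) :
  0 <= a -> 0 <= b -> measurable A ->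
  (\int[mu]_z (a%:E * (\1_A z)%:E + b%:E * m A) = a%:E * mu A + b%:E * m A * mu setT)%E.
Proof.
move=> a0 b0 mA; rewrite ge0_integralD//.
- congr (_ + _)%E; last by rewrite integral_cst.
  by rewrite ge0_integralZl// ?integral_indic ?setIT//; apply/measurable_EFinP; exact: measurable_indic.
- by move=> x _; rewrite mule_ge0// lee_fin.
- by apply: measurable_funeM; apply/measurable_EFinP; exact: measurable_indic.
- by move=> x _; rewrite mule_ge0// lee_fin.
Qed.

Let p0 : 0 <= p. Proof. by case/andP: p01. Qed.
Let p1 : 0 <= 1 - p. Proof. by rewrite subr_ge0; case/andP: p01. Qed.

Lemma integral_sticky (mu : {measure set T -> \bar R}) A : measurable A ->
  (\int[mu]_z sticky p01 z A = (1 - p)%:E * mu A + p%:E * m A * mu setT)%E.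
Proof.
by move=> mA; under eq_integral do rewrite stickyE; rewrite integral_indic_cst.
Qed.

Lemma integral_sticky_prob (mu : probability T R) A : measurable A ->
  (\int[mu]_z sticky p01 z A = (1 - p)%:E * mu A + p%:E * m A)%E.
Proof.
move=> mA; rewrite integral_sticky//; congr (_ + _)%E.
by rewrite [X in (_ * X)%E](probability_setT mu) mule1.
Qed.

Lemma sticky_invariant : invariant_distribution (sticky p01) m.
Proof.
move=> A mA; rewrite integral_sticky_prob//.
by rewrite -(fineK (fin_num_measure m A mA)) -!EFinM -EFinD -mulrDl subrK mul1r.
Qed.

(** Invariance reads [(1 - p) * m' + p * m = m'], and [p] can be cancelled. *)
Lemma sticky_unique (m' : probability T R) : 0 < p ->
  invariant_distribution (sticky p01) m' ->
  forall A, measurable A -> m' A = m A.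
Proof.
move=> pp inv A mA; have := inv A mA.
rewrite integral_sticky_prob//.
rewrite -(fineK (fin_num_measure m' A mA)) -(fineK (fin_num_measure m A mA)).
rewrite -!EFinM -EFinD => -[h]; congr EFin.
move: h; set f := fine _; set g := fine _ => h.
apply: (mulfI (lt0r_neq0 pp)); apply/eqP; rewrite -subr_eq0.
have -> : p * f - p * g = f - ((1 - p) * f + p * g) by ring.
by rewrite h subrr.
Qed.

Lemma kernel_iter_sticky k z A : measurable A ->
  kernel_iter (sticky p01) k z A =
    (((1 - p) ^+ k)%:E * (\1_A z)%:E + (1 - (1 - p) ^+ k)%:E * m A)%E.
Proof.
elim: k A => [|k IH] A mA.
  by rewrite /= expr0 mul1e subrr mul0e adde0.
rewrite /= /mkcomp_noparam /kcomp_noparam integral_sticky//.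
rewrite !IH// indicT/= probability_setT -(fineK (fin_num_measure m A mA)).
rewrite -!EFinM -!EFinD; congr EFin; rewrite exprS.
set q := (1 - p) ^+ k; set i := \1_A z; set f := fine _.
ring.
Qed.

(** The parts of the two laws that come from a redraw coincide, and the difference
    is [(1 - p) ^ k] times a difference of Dirac masses. Its value on each of the
    two sets of a Hahn decomposition is at most [(1 - p) ^ k] in absolute
    value. *)
Lemma tv_norm_sticky k z z' :
  ((1 / 2)%:E * tv_norm (charge_sub (kernel_iter_at (sticky p01) k z)
                                   (kernel_iter_at (sticky p01) k z'))
    <= ((1 - p) ^+ k)%:E)%E.
Proof.
set nu := charge_sub _ _.
have nuE A : measurable A ->
    nu A = ((1 - p) ^+ k * (\1_A z - \1_A z'))%:E.
  move=> mA; transitivity (kernel_iter (sticky p01) k z A - kernel_iter (sticky p01) k z' A)%E => //.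
  rewrite !kernel_iter_sticky// -(fineK (fin_num_measure m A mA)).
  rewrite -!EFinM -!EFinD; congr EFin.
  set q := (1 - p) ^+ k; set f := fine _; ring.
rewrite /tv_norm; case: cid => /= Pp hP; case: cid => /= Nn hN.
have [[mP _] [mN _] _ _] := hN.
rewrite [charge_variation _ _](_ : _ = (nu Pp + - nu Nn)%E); last first.
  rewrite /charge_variation /= jordan_posE jordan_negE cjordan_posE cjordan_negE.
  by rewrite /crestr0 mem_set// /crestr !setTI.
rewrite (nuE _ mP) (nuE _ mN) -EFinN -EFinD -EFinM lee_fin.
set q := (1 - p) ^+ k; have q0 : 0 <= q by rewrite exprn_ge0.
have bd A : (-1 : R) <= (\1_A z : R) - (\1_A z' : R) <= (1 : R).
  by rewrite !indicE; case: (z \in A); case: (z' \in A); rewrite /= ?mulr1n ?mulr0n; apply/andP; split; lra.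
have := bd Pp; have := bd Nn.
set a := _ - _; set b := _ - _ => /andP[a1 a2] /andP[b1 b2].
nra.
Qed.
End StickyKernel.

(** * The sticky chain is Markov and stationary *)

Section StickyChain.
Context {R : realType} {dO : measure_display} {Omega : measurableType dO}.
Context (P : probability Omega R) {S : finType} (Y : nat -> Omega -> S).
Context (p : R) (r : S -> R).
Hypothesis p01 : 0 <= p <= 1.
Hypothesis r1 : \sum_a r a = 1.
Hypothesis law : forall s : seq S,
  measurable [set x | path_at Y (size s) x = s] /\
  P [set x | path_at Y (size s) x = s] = (path_weight p r s)%:E.

Context {dT : measure_display} {T : measurableType dT} (code : S -> T).

Local Notation X := (code_chain law code).

Let ind (A : set T) (a : S) : R := (`[< A (code a) >])%:R.

Lemma distribution_code_chain0 A :
  distribution P (X 0%N) A = (\sum_a r a * ind A a)%:E.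
Proof.
transitivity (P [set x | [set s | exists r a, s = rcons r a /\ A (code a)]
    (path_at Y 1 x)]).
  congr (P _); apply/seteqP; split => x; rewrite /preimage/= /path_at mkseqS/=.
    by move=> Ax; exists [::], (Y 0%N x).
  by move=> [s [a [/(@rcons_inj _ [::] _ _ _)[_ ->]]]].
rewrite (P_path_event law); congr EFin.
rewrite (big_tuple_cons 0 (fun s => path_weight p r s *
  (`[< [set s | exists r a, s = rcons r a /\ A (code a)] s >])%:R)).
apply: eq_bigr => a _; rewrite (bigD1 [tuple])//= big1 ?addr0 ?mulr1.
  congr (_ * (_ %:R)); congr nat_of_bool; apply/asbool_equiv_eq; split.
    by move=> [s [b [/(@rcons_inj _ [::] _ _ _)[_ ->]]]].
  by move=> Aa; exists [::], a.
by move=> t /negP[]; exact/eqP/tuple0.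
Qed.

Let at0 (g : T -> R) (s : seq S) : R := if s is a :: _ then g (code a) else 0.

Let integrable_at0 (g : T -> R) :
  P.-integrable (X 0%N @^-1` setT) ((EFin \o g) \o X 0%N).
Proof.
rewrite preimage_setT.
exact: (@integrable_path_at _ _ _ _ _ _ _ law 1 (at0 g)).
Qed.

Lemma integrable_initial_law (g : T -> R) : measurable_fun setT g ->
  (distribution P (X 0%N)).-integrable setT (EFin \o g).
Proof.
move=> mg; apply: integrable_pushforward => //.
exact/measurable_EFinP.
Qed.

Lemma expectation_initial_law (g : T -> R) : measurable_fun setT g ->
  ('E_(distribution P (X 0%N))[g] = (\sum_a r a * g (code a))%:E)%E.
Proof.
move=> mg; rewrite unlock.
transitivity (\int[P]_(x in X 0%N @^-1` setT) ((EFin \o g) \o X 0%N) x)%E.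
  apply: integral_pushforward => //; first exact/measurable_EFinP.
  exact: integrable_at0.
rewrite preimage_setT.
transitivity (\int[P]_x (at0 g (path_at Y 1 x))%:E)%E; first by [].
rewrite (integral_path_at law) (big_tuple_cons 0 (fun s => path_weight p r s * at0 g s)).
congr EFin; apply: eq_bigr => a _; rewrite (bigD1 [tuple])//= big1 ?addr0 ?mulr1//.
by move=> t /negP[]; exact/eqP/tuple0.
Qed.

Lemma step_weight_ind A b : \sum_a step_weight p r b a * ind A a =
  (1 - p) * ind A b + p * \sum_a r a * ind A a.
Proof.
transitivity (\sum_a ((1 - p) * ((b == a)%:R * ind A a) + p * (r a * ind A a))).
  by apply: eq_bigr => a _; rewrite /step_weight; ring.
rewrite big_split/= -!mulr_sumr; congr (_ * _ + _).
rewrite (bigD1 b)//= eqxx mul1r big1 ?addr0// => a ab.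
by rewrite eq_sym (negbTE ab) mul0r.
Qed.

(** An event of the past is a set of words ([natural_filtration_path]), and on
    words the Markov property is the product formula [path_weight_rcons]. *)
Lemma sticky_markov_chain :
  markov_chain (sticky (distribution P (X 0%N)) p01) (distribution P (X 0%N)) X.
Proof.
split=> // n A B mA /natural_filtration_path[E ->].
pose E' : set (seq S) := [set s | exists s' a, [/\ s = rcons s' a, E s' & A (code a)]].
have -> : [set x | E (path_at Y n.+1 x)] `&` X n.+1 @^-1` A = [set x | E' (path_at Y n.+2 x)].
  apply/seteqP; split => x; rewrite /preimage/=.
    move=> [Ex Ax]; exists (path_at Y n.+1 x), (Y n.+1 x); split=> //.
    by rewrite [in LHS]/path_at mkseqS.
  move=> [s [a []]]; rewrite [in X in X -> _]/path_at mkseqS.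
  by move=> /rcons_inj[<- <-].
rewrite (P_path_event law).
pose G (s : seq S) : R := if s is a :: s' then
  (1 - p) * ind A (last a s') + p * \sum_a r a * ind A a else 0.
transitivity (\int[P]_(x in [set x | E (path_at Y n.+1 x)]) (G (path_at Y n.+1 x))%:E)%E; last first.
  apply: eq_integral => x _; rewrite stickyE [X in (_ + _ * X)%E](distribution_code_chain0 A).
  rewrite -!EFinM -EFinD; congr EFin; rewrite /G.
  have -> : path_at Y n.+1 x = rcons (path_at Y n x) (Y n x).
    by rewrite /path_at mkseqS.
  case: (path_at Y n x) => [|a s]/=; rewrite ?last_rcons.
    congr (_ * _ + _); rewrite indicE /ind; congr (_%:R); congr nat_of_bool.
  congr (_ * _ + _).
rewrite (integral_path_event law); congr EFin.
rewrite (big_tuple_rcons n.+1 (fun s => path_weight p r s * (`[< E' s >])%:R)).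
apply: eq_bigr => t _.
rewrite (eq_bigr (fun a => path_weight p r (rcons t a) * ((`[< E t >])%:R * ind A a))); last first.
  move=> a _; congr (_ * _); rewrite /ind -natrM mulnb; congr (_%:R); congr nat_of_bool.
  apply/asboolP/andP.
    by move=> [s [b [/rcons_inj[-> ->] /asboolT-> /asboolT->]]].
  by move=> [/asboolP Et /asboolP Aa]; exists t, a.
case: t => /= s; case/lastP: s => [//|s b] _.
under eq_bigr do rewrite path_weight_rcons -mulrA mulrCA.
have -> : G (rcons s b) = (1 - p) * ind A b + p * \sum_a r a * ind A a.
  by rewrite /G; case: s => [|c s]//=; rewrite last_rcons.
rewrite -step_weight_ind !mulr_sumr; apply: eq_bigr => a _; ring.
Qed.

(** Shifting by one step amounts to summing out the first symbol of a word. *)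
Lemma sticky_stationary : stationary_process X.
Proof.
move=> k n A mA.
pose E : set (seq S) := [set s | forall i a, (i < size s)%N -> A i (code (nth a s i))].
have ev j : \big[setI/setT]_(i < n) (X (j + i)%N @^-1` A i) =
    [set x | [set s | E (drop j s)] (path_at Y (j + n) x)].
  rewrite -(bigcap_mkord n (fun i => X (j + i)%N @^-1` A i)).
  apply/seteqP; split => x /=.
    move=> h i a; rewrite size_drop size_mkseq addKn => ni.
    rewrite nth_drop nth_mkseq ?ltn_add2l//; exact: (h i).
  move=> h i ni; have := h i (Y (j + i)%N x).
  by rewrite size_drop size_mkseq addKn nth_drop nth_mkseq ?ltn_add2l//; apply.
have -> : \big[setI/setT]_(i < n) (X i @^-1` A i) =
    [set x | [set s | E (drop 0 s)] (path_at Y (0 + n) x)].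
  by rewrite -ev.
rewrite ev !(P_path_event law); congr EFin.
elim: k => [//|k IH]; rewrite -{}IH addSn.
rewrite (big_tuple_cons (k + n) (fun s => path_weight p r s * (`[< [set s | E (drop k.+1 s)] s >])%:R)).
rewrite exchange_big/=; apply: eq_bigr => t _.
by rewrite -mulr_suml (path_weight_suml _ _ r1).
Qed.

End StickyChain.

(** * The discrete cube, and Borel measurability on row vectors *)

(** The real type is a phantom parameter: the metric on the cube takes its values
    there, and instance inference must be able to find it from the carrier. *)
Definition signs (R : realType) (d : nat) : Type := {ffun 'I_d -> bool}.

HB.instance Definition _ (R : realType) (d : nat) := Finite.copy (signs R d) {ffun 'I_d -> bool}.
HB.instance Definition _ (R : realType) (d : nat) :=
  isPointed.Build (signs R d) [ffun=> false].

Section DiscreteMetric.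
Context {R : realType} {d : nat}.
Local Notation S := (signs R d).

Let sdist (x y : S) : R := (x != y)%:R.

Let sdistxx x : sdist x x = 0. Proof. by rewrite /sdist eqxx. Qed.

Let sdist_positivity x y : sdist x y = 0 -> x = y.
Proof. by rewrite /sdist; case: eqP => //= _ /eqP; rewrite oner_eq0. Qed.

Let sdist_sym x y : sdist x y = sdist y x.
Proof. by rewrite /sdist eq_sym. Qed.

Let sdist_triangle y x z : sdist x z <= sdist x y + sdist y z.
Proof.
rewrite /sdist -natrD ler_nat; have [->|] := eqVneq x y; first by rewrite add0n.
by move=> _; case: (x != z).
Qed.

HB.instance Definition _ := isMetric.Build R S
  sdistxx sdist_positivity sdist_sym sdist_triangle.

Lemma signs_ball1 (x y : S) : ball x (1 : R) y -> y = x.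
Proof.
rewrite ballEmdist/= /mdist/= /sdist; case: eqP => //=.
by rewrite ltxx.
Qed.

Lemma signs_open (A : set S) : open A.
Proof.
rewrite openE => x Ax; apply/nbhs_ballP; exists 1 => //= y /signs_ball1 ->.
exact: Ax.
Qed.

Let signs_complete (F : set_system S) : ProperFilter F -> cauchy F -> cvg F.
Proof.
move=> FF /cauchyP/(_ _ ltr01)[x Fx].
apply/cvg_ex; exists x => A /nbhs_singleton Ax.
by apply: filterS Fx => y /signs_ball1 ->.
Qed.

HB.instance Definition _ := Uniform_isComplete.Build S signs_complete.

Lemma signs_separable : separable S.
Proof.
exists setT; first exact: countableP.
by move=> O [x Ox] _; exists x; split.
Qed.

Lemma signs_measurable (A : set (borel S)) : measurable A.
Proof. by apply: sub_sigma_algebra; exact: (@signs_open A). Qed.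

Lemma signs_measurable_fun d' (T : measurableType d') (f : borel S -> T) :
  measurable_fun setT f.
Proof. by move=> _ A _; exact: signs_measurable. Qed.

End DiscreteMetric.

Section BorelRow.
Context {R : realType} {d : nat}.

Lemma continuous_borel_measurable (T : ptopologicalType) (f : T -> R) :
  continuous f -> measurable_fun setT (f : borel T -> R).
Proof.
move=> cf; move/continuousP : cf => cf.
apply: (measurability _ (RGenOpens.measurableE R)) => _ [_ [a [b ->] <-]].
by rewrite setTI; apply: sub_sigma_algebra; exact/cf/interval_open.
Qed.

Lemma measurable_coord j : measurable_fun setT
   ((fun x : 'rV[R]_d => x ord0 j) : borel 'rV[R]_d -> R).
Proof. by apply: continuous_borel_measurable; exact: coord_continuous. Qed.
End BorelRow.

(** * The oracle and its objective *)

Section Oracle.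
Context {R : realType} {d : nat} (mu D eps : R).
Local Notation S := (signs R d).

(** No sign vector occurs here: the instances differ only in the law of the
    state. *)
Definition oracle (x : 'rV[R]_d) (z : borel S) : R :=
  \sum_j mu * (375 / 169 * x ord0 j ^+ 2
               - eps^-1 * sgnb (z j) * (D ^+ 2 * psi (x ord0 j / D))).

Definition landscape (v : S) (x : 'rV[R]_d) : R^o :=
  \sum_j well mu D (v j) (x ord0 j).

Definition landscape_grad (v : S) (x : 'rV[R]_d) : 'rV[R]_d :=
  \row_j dwell mu D (v j) (x ord0 j).

Definition landscape_min (v : S) : 'rV[R]_d := \row_j (sgnb (v j) * (D / 5)).

Lemma psi_continuous : continuous (@psi R).
Proof.
move=> t; apply: cvgM; first exact: cvg_id.
apply: (@continuousV _ _ (fun t : R => 1 + t ^+ 2)).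
  by rewrite gt_eqF// ltr_wpDr ?sqr_ge0.
apply: cvgD; first exact: cvg_cst.
exact: exprn_continuous.
Qed.

Lemma measurable_oracle : measurable_fun setT
  (fun xz : borel 'rV[R]_d * borel S => oracle xz.1 xz.2).
Proof.
apply: measurable_sum => j.
have mx : measurable_fun setT (fun xz : borel 'rV[R]_d * borel S => xz.1 ord0 j).
  exact: measurableT_comp (measurable_coord j) measurable_fst.
have mz : measurable_fun setT
    (fun xz : borel 'rV[R]_d * borel S => sgnb ((xz.2 : S) j) : R).
  have mf : measurable_fun setT (fun z : borel S => sgnb ((z : S) j) : R).
    exact: signs_measurable_fun.
  exact: measurableT_comp mf measurable_snd.
apply: measurable_funM; first exact: measurable_cst.
apply: measurable_funB.
  by apply: measurable_funM => //; exact: measurable_funX.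
apply: measurable_funM; first exact: measurable_funM.
apply: measurable_funM => //.
apply: (measurableT_comp (continuous_measurable_fun psi_continuous)).
exact: measurable_funM.
Qed.

Hypotheses (mu0 : 0 < mu) (D0 : 0 < D) (eps0 : 0 < eps).

Lemma oracle_mean v x : \sum_z coins eps v z * oracle x z = landscape v x.
Proof.
rewrite /oracle; under eq_bigr do rewrite mulr_sumr.
rewrite exchange_big/=; apply: eq_bigr => j _; rewrite /well.
transitivity (\sum_(z : S) (mu * (375 / 169 * x ord0 j ^+ 2) * coins eps v z -
  mu * eps^-1 * (D ^+ 2 * psi (x ord0 j / D)) * (coins eps v z * sgnb (z j)))).
  by apply: eq_bigr => z _; ring.
rewrite sumrB -!mulr_sumr.
rewrite (coins_mean_sgn eps v j) (sum_coins eps v).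
have : eps != 0 by rewrite gt_eqF.
by move=> e0; field.
Qed.

Lemma oracle_variance v x :
  \sum_z coins eps v z * `|oracle x z - landscape v x| ^+ 2 <=
    d%:R * (mu * D ^+ 2 / (2 * eps)) ^+ 2.
Proof.
have e0 : eps != 0 by rewrite gt_eqF.
pose a j := - (mu * D ^+ 2 / eps * psi (x ord0 j / D)).
rewrite (eq_bigr (fun z => coins eps v z *
    (\sum_j a j * (sgnb (z j) - eps * sgnb (v j))) ^+ 2)); last first.
  move=> z _; congr (_ * _); rewrite real_normK ?num_real//; congr (_ ^+ 2).
  rewrite /oracle /landscape -sumrB; apply: eq_bigr => j _.
  by rewrite /well /a; field.
rewrite coins_variance.
apply: (@le_trans _ _ (\sum_j a j ^+ 2)).
  rewrite ler_piMl ?sumr_ge0//; first by move=> j _; exact: sqr_ge0.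
  by rewrite lerBlDr lerDl sqr_ge0.
rewrite mulr_natl -[X in _ *+ X]card_ord -sumr_const; apply: ler_sum => j _.
rewrite /a sqrrN exprMn.
have -> : (mu * D ^+ 2 / (2 * eps)) ^+ 2 = (mu * D ^+ 2 / eps) ^+ 2 * (1 / 4) by field.
by rewrite ler_wpM2l ?sqr_ge0 ?psi_bounded.
Qed.

(** Both the objective and the squared Euclidean norm are sums over coordinates,
    so the one-dimensional bound [well_taylor] adds up. *)
Lemma landscape_taylor v x y :
  `|landscape v x - landscape v y - dotv (landscape_grad v y) (x - y)
     - mu * (375 / 169) * enorm (x - y) ^+ 2| <= mu * (3 / 2) * enorm (x - y) ^+ 2.
Proof.
rewrite enorm_sqr !mulr_sumr /dotv /landscape -!sumrB.
apply: (le_trans (ler_norm_sum _ _ _)); apply: ler_sum => j _.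
by rewrite !mxE; exact: well_taylor.
Qed.

Let taylor_bound v x y :
  `|landscape v x - landscape v y - dotv (landscape_grad v y) (x - y)|
     <= mu * 4 * enorm (x - y) ^+ 2.
Proof.
have := landscape_taylor v x y; have := mulr_ge0 (ltW mu0) (sqr_ge0 (enorm (x - y))).
rewrite -!mulrA !(mulrCA mu) !ler_norml => h /andP[h1 h2]; apply/andP; split; lra.
Qed.

Lemma landscape_differentiable v x : differentiable (landscape v) x.
Proof. exact: differentiable_of_taylor (taylor_bound v) x. Qed.

Lemma landscape_gradient v x : gradient (landscape v) x = landscape_grad v x.
Proof. exact: gradient_of_taylor (taylor_bound v) x. Qed.

Lemma landscape_convex v : strongly_convex mu (landscape v).
Proof.
move=> x y; rewrite landscape_gradient.
have := landscape_taylor v x y; have := mulr_ge0 (ltW mu0) (sqr_ge0 (enorm (x - y))).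
rewrite -!mulrA !(mulrCA mu) !ler_norml => h /andP[h1 h2].
rewrite (mulrC 2^-1) mulrA; lra.
Qed.

Lemma landscape_smooth v x y :
  enorm (gradient (landscape v) x - gradient (landscape v) y)
    <= mu * 8 * enorm (x - y).
Proof.
rewrite !landscape_gradient; apply: enorm_le_coord.
  by rewrite mulr_ge0// ltW.
by move=> j; rewrite !mxE; exact: dwell_lipschitz.
Qed.

Lemma landscape_minimizer v : minimizer (landscape v) (landscape_min v).
Proof.
move=> x; have := landscape_convex v x (landscape_min v).
rewrite landscape_gradient /dotv big1 ?subr0 => [h|j _].
  by rewrite -subr_ge0 (le_trans _ h)// mulr_ge0 ?sqr_ge0// divr_ge0// ltW.
by rewrite mxE mxE dwell_min ?mul0r.
Qed.

End Oracle.

(** * The hard instance, and replaying an algorithm along a path *)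

Section HardInstance.
Context {R : realType} {d : nat} (mu D eps p : R) (v : signs R d).
Hypothesis p01 : 0 <= p <= 1.
Context {dO : measure_display} {Omega : measurableType dO}.
Context (P : probability Omega R) (Y : nat -> Omega -> signs R d).
Hypothesis law : forall s : seq (signs R d),
  measurable [set x | path_at Y (size s) x = s] /\
  P [set x | path_at Y (size s) x = s] = (path_weight p (coins eps v) s)%:E.

Definition hard_chain (n : nat) : {RV P >-> borel (signs R d)} :=
  code_chain law (fun z => z : borel (signs R d)) n.

Definition hard_instance : one_point_data R d :=
  @OnePointData R d (signs R d) (sticky (distribution P (hard_chain 0%N)) p01)
    (distribution P (hard_chain 0%N)) _ _ P hard_chain (oracle mu D eps).

Hypotheses (mu0 : 0 < mu) (D0 : 0 < D) (eps0 : 0 < eps).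

Lemma hard_objective : objective hard_instance = landscape mu D v.
Proof.
apply/funext => x; rewrite /objective /=.
rewrite (@expectation_initial_law _ _ _ _ _ _ _ _ law _ _ _ (oracle mu D eps x)) /=.
  exact: (oracle_mean _ _ eps0).
exact: signs_measurable_fun.
Qed.

Lemma sticky_rate (tau k : nat) :
  (1 - p) ^+ tau <= 1 / 4 -> (1 - p) ^+ k <= (1 / 4) ^+ (k %/ tau).
Proof.
move=> ht; have q0 : 0 <= 1 - p by rewrite subr_ge0; case/andP: p01.
have q1 : 1 - p <= 1 by rewrite gerBl; case/andP: p01.
apply: (@le_trans _ _ ((1 - p) ^+ (tau * (k %/ tau)))).
  by apply: ler_wiXn2l => //; rewrite mulnC; exact: leq_divM.
by rewrite exprM lerXn2r ?nnegrE ?exprn_ge0.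
Qed.

(** Only two clauses constrain the sizes of the parameters: mixing asks [p] to be
    large, and the variance asks [D ^ 2] to be small compared with [eps]. *)
Lemma hard_instance_valid (tau : nat) (sigma1 : R) : 0 < p ->
  (1 - p) ^+ tau <= 1 / 4 ->
  d%:R * (mu * D ^+ 2 / (2 * eps)) ^+ 2 <= sigma1 ^+ 2 ->
  one_point_instance tau mu sigma1 hard_instance.
Proof.
move=> p0 mix var.
have c1 : \sum_(z : signs R d) coins eps v z = 1 := sum_coins eps v.
split.
- exact: signs_separable.
- exact: sticky_invariant.
- move=> m' inv A mA; exact: (sticky_unique p0 inv mA).
- move=> k z z'; apply: (le_trans (tv_norm_sticky _ _ _ _ _)).
  by rewrite lee_fin; exact: sticky_rate.
- exact: sticky_markov_chain.
- exact: sticky_stationary.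
- exact: measurable_oracle.
- move=> x; apply: integrable_initial_law; exact: signs_measurable_fun.
- by move=> x; rewrite hard_objective; exact: landscape_differentiable.
- exists (mu * 8); first by rewrite mulr_gt0.
  by move=> x y; rewrite hard_objective; exact: landscape_smooth.
- by rewrite hard_objective; exact: landscape_convex.
- move=> x; rewrite hard_objective.
  rewrite (@expectation_initial_law _ _ _ _ _ _ _ _ law _ _ _
    (fun z => `|oracle mu D eps x z - landscape mu D v x| ^+ 2)).
    by rewrite lee_fin; apply: le_trans var; exact: oracle_variance.
  exact: signs_measurable_fun.
Qed.

End HardInstance.

Section Replay.
Context {R : realType} {d N : nat} (a : one_point_algorithm R d N).
Context {Z : Type} (F : 'rV[R]_d -> Z -> R).

(** The answers to the algorithm as a function of a sequence of states, with no
    probability space: the same function serves all instances. *)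
Fixpoint replay (u : alg_seed a) (z : nat -> Z) (k : nat) : k.-tuple R :=
  if k is k'.+1 then
    let y := replay u z k' in [tuple of rcons y (F (alg_query a (u, y)) (z k'))]
  else [tuple].

Lemma replay_ext u z z' k : (forall i, (i < k)%N -> z i = z' i) ->
  replay u z k = replay u z' k.
Proof.
elim: k => //= k IH zz'.
by rewrite IH ?zz'// => i ik; apply: zz'; rewrite ltnS ltnW.
Qed.

Hypothesis mF : forall z, measurable_fun setT (F^~ z : borel 'rV[R]_d -> R).

Lemma measurable_replay z k : measurable_fun setT (fun u => replay u z k).
Proof.
elim: k => [|k IH]; first by apply/measurable_fun_tnthP => -[].
have mlast : measurable_fun setT (fun u => F (alg_query a (u, replay u z k)) (z k)).
  apply: (measurableT_comp (mF (z k))).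
  apply: (measurableT_comp (@alg_query_measurable _ _ _ a k)).
  exact: measurable_fun_pair.
apply/measurable_fun_tnthP => i.
have [ik|ik] := ltnP i k.
  rewrite (_ : _ \o _ = fun u => tnth (replay u z k) (Ordinal ik)).
    by move/measurable_fun_tnthP: IH; exact.
  by apply/funext => u /=; rewrite !(tnth_nth 0)/= nth_rcons size_tuple ik.
rewrite (_ : _ \o _ = fun u => F (alg_query a (u, replay u z k)) (z k)) //.
apply/funext => u /=; rewrite (tnth_nth 0)/= nth_rcons size_tuple ltnNge ik/=.
by have -> : i = k :> nat; [apply/eqP; rewrite eqn_leq ik -ltnS ltn_ord | rewrite eqxx].
Qed.

End Replay.

Lemma observations_replay (R : realType) (d N : nat) (a : one_point_algorithm R d N)
    (I : one_point_data R d) u w k :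
  observations u w k = replay (a := a) (op_F I) u (fun i => op_chain I i w) k.
Proof. by elim: k => //= k ->. Qed.

(** * The risk on a hard instance *)

Section Risk.
Context {R : realType} {d N : nat} (a : one_point_algorithm R d N) (mu D eps p : R).
Hypothesis p01 : 0 <= p <= 1.
Local Notation S := (signs R d).

(** The estimate as a function of the seed and of a word of states; the default
    [point] is never read on words of length [N]. *)
Definition replayed_estimate (u : alg_seed a) (s : seq S) : 'rV[R]_d :=
  alg_output a (u, replay (a := a) (oracle mu D eps) u (nth point s) N).

Definition sqdist (x y : 'rV[R]_d) : R := \sum_j (x ord0 j - y ord0 j) ^+ 2.

Lemma measurable_sqdist_estimate s y :
  measurable_fun setT (fun u => sqdist (replayed_estimate u s) y).
Proof.
have me : measurable_fun setT (fun u => replayed_estimate u s : borel 'rV[R]_d).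
  have mp : measurable_fun setT
      (fun u => (u, replay (a := a) (oracle mu D eps) u (nth point s) N)).
    apply: measurable_fun_pair => //; apply: measurable_replay => z.
    have mxz : measurable_fun setT (fun x : borel 'rV[R]_d => (x, z : borel S)).
      exact: measurable_fun_pair.
    exact: (measurableT_comp (measurable_oracle mu D eps) mxz).
  exact: (measurableT_comp (@alg_output_measurable _ _ _ a) mp).
apply: measurable_sum => j; apply: measurable_funX; apply: measurable_funB => //.
exact: (measurableT_comp (measurable_coord j) me).
Qed.

Context {dO : measure_display} {Omega : measurableType dO}.
Variables (v : S) (P : probability Omega R) (Y : nat -> Omega -> S).
Hypothesis law : forall s : seq S,
  measurable [set x | path_at Y (size s) x = s] /\
  P [set x | path_at Y (size s) x = s] = (path_weight p (coins eps v) s)%:E.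

Lemma estimate_replayed u x :
  estimate (a := a) (I := hard_instance mu D p01 law) u x
    = replayed_estimate u (path_at Y N x).
Proof.
rewrite /estimate observations_replay /replayed_estimate; congr (alg_output _ (_, _)).
by apply: replay_ext => i iN; rewrite /path_at nth_mkseq.
Qed.

(** Tonelli's theorem, followed by the integration over the chain, which is a
    finite sum over words. *)
Lemma risk_hard_instance y :
  (risk a (hard_instance mu D p01 law) y = \int[alg_law a]_u
    (\sum_(s : N.-tuple S) path_weight p (coins eps v) s * sqdist (replayed_estimate u s) y)%:E)%E.
Proof.
rewrite /risk.
pose f (uw : alg_seed a * Omega) : R := sqdist (replayed_estimate uw.1 (path_at Y N uw.2)) y.
transitivity (\int[alg_law a \x P]_uw (f uw)%:E)%E.
  apply: eq_integral => -[u x] _; congr EFin.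
  rewrite [estimate _ _](estimate_replayed u x) enorm_sqr /f /sqdist.
  by apply: eq_bigr => j _; rewrite !mxE.
rewrite fubini_tonelli1.
- apply: eq_integral => u _; rewrite /fubini_F.
  exact: (integral_path_at law N (fun s => sqdist (replayed_estimate u s) y)).
- apply/measurable_EFinP.
  rewrite (_ : f = fun uw => \sum_(t : N.-tuple S) sqdist (replayed_estimate uw.1 t) y *
      \1_[set x | path_at Y N x = t] uw.2); last first.
    apply/funext => -[u x]; rewrite /f/=.
    exact: (path_at_sum Y N (fun s => sqdist (replayed_estimate u s) y)).
  apply: measurable_sum => t; apply: measurable_funM.
    exact: (measurableT_comp (measurable_sqdist_estimate t y)).
  apply: (measurableT_comp _ measurable_snd); apply: measurable_indic.
  by have [] := law t; rewrite size_tuple.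
- by move=> uw; rewrite lee_fin; apply: sumr_ge0 => j _; exact: sqr_ge0.
Qed.

End Risk.

(** If all risks were below the bound, so would be their average. For each fixed
    seed, however, the estimate is a function of the word of states, to which
    [assouad] applies; integrating over the seed keeps the bound. *)
Lemma exists_hard_instance (R : realType) (d n : nat) (mu D eps p : R)
    (a : one_point_algorithm R d n.+1) (p01 : 0 <= p <= 1) :
  0 <= eps <= 1 -> eps ^+ 2 * (1 + n%:R * p) <= 1 / 4 ->
  exists (v : signs R d) (P : probability (measurableTypeR R) R)
    (Y : nat -> R -> signs R d)
    (law : forall s : seq (signs R d),
      measurable ([set x | path_at Y (size s) x = s] : set (measurableTypeR R)) /\
      P [set x | path_at Y (size s) x = s] = (path_weight p (coins eps v) s)%:E),
  ((d%:R * (D / 5) ^+ 2 / 2)%:E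
     <= risk a (hard_instance mu D p01 law) (landscape_min D v))%E.
Proof.
move=> eps01 info; set c := d%:R * (D / 5) ^+ 2 / 2.
have c0 : 0 <= c by rewrite divr_ge0// mulr_ge0// sqr_ge0.
have proc (v : signs R d) : exists PY : probability (measurableTypeR R) R * (nat -> R -> signs R d),
  forall s : seq (signs R d),
      measurable ([set x | path_at PY.2 (size s) x = s] : set (measurableTypeR R)) /\
      PY.1 [set x | path_at PY.2 (size s) x = s] = (path_weight p (coins eps v) s)%:E.
  have [|||P [Y h]] := @exists_process R (signs R d) point (path_weight p (coins eps v)).
  - by move=> s; apply: path_weight_ge0 => // z; exact: coins_ge0.
  - by [].
  - by move=> s; apply: path_weight_sumr; exact: sum_coins.
  by exists (P, Y).
have {proc}[PY law] := choice proc.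
pose rk v := risk a (hard_instance mu D p01 (law v)) (landscape_min D v).
suff [v cv] : exists v, (c%:E <= rk v)%E by exists v, (PY v).1, (PY v).2, (law v).
apply: contrapT => /forallNP no.
pose g (v : signs R d) (u : alg_seed a) := \sum_(s : n.+1.-tuple (signs R d)) path_weight p (coins eps v) s *
  sqdist (replayed_estimate mu D eps u s) (landscape_min D v) : R.
have g0 v u : 0 <= g v u.
  apply: sumr_ge0 => s _; rewrite mulr_ge0 ?sumr_ge0// => [|j _]; last exact: sqr_ge0.
  by apply: path_weight_ge0 => // z; exact: coins_ge0.
have rkE v : rk v = (\int[alg_law a]_u (g v u)%:E)%E by exact: risk_hard_instance.
have rk0 v : (0 <= rk v)%E by rewrite rkE; apply: integral_ge0 => u _; rewrite lee_fin.
have rkc v : (rk v < c%:E)%E by rewrite ltNge; apply/negP; exact: no.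
have mg v : measurable_fun setT (fun u => (g v u)%:E).
  apply/measurable_EFinP; apply: measurable_sum => s.
  apply: measurable_funM => //; exact: measurable_sqdist_estimate.
have fin v : rk v \is a fin_num by rewrite ge0_fin_numE// (lt_trans (rkc v))// ltry.
have lb : ((#|{: signs R d}|%:R * c)%:E <= \sum_v rk v)%E.
  rewrite (eq_bigr _ (fun v _ => rkE v)) -ge0_integral_sum//; last first.
    by move=> v u _; rewrite lee_fin.
  apply: (@le_trans _ _ (\int[alg_law a]_u (#|{: signs R d}|%:R * c)%:E)%E).
    by rewrite integral_cst// [X in (_ * X)%E](probability_setT (alg_law a)) mule1.
  apply: ge0_le_integral => //.
  - by move=> u _; rewrite lee_fin mulr_ge0.
  - by apply: emeasurable_sum => v; exact: mg.
  move=> u _; rewrite sumEFin lee_fin.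
  have := assouad (D / 5) p01 eps01 info (fun s j => replayed_estimate mu D eps u s ord0 j).
  move/le_trans; apply; apply: ler_sum => v _; apply: ler_sum => s _.
  rewrite /sqdist le_eqVlt; apply/orP; left; apply/eqP; congr (_ * _).
  by apply: eq_bigr => j _; rewrite mxE.
have : (\sum_v rk v < (#|{: signs R d}|%:R * c)%:E)%E.
  rewrite (eq_bigr (fun v => (fine (rk v))%:E)); last by move=> v _; rewrite fineK.
  rewrite sumEFin lte_fin mulr_natl -sumr_const; apply: ltr_sum.
    by apply/hasP; exists point => //; rewrite mem_index_enum.
  by move=> v _; rewrite -lte_fin fineK.
by rewrite ltNge lb.
Qed.

(** * Choice of the parameters *)

(** Bernoulli's inequality for [(1 + 3 / x) ^ k.+1], cleared of denominators so
    that [x = 0] is allowed. *)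
Lemma bernoulli3 (R : realFieldType) (x : R) (k : nat) : 0 <= x ->
  x ^+ k * (x + 3 * k.+1%:R) <= (x + 3) ^+ k.+1.
Proof.
move=> x0; elim: k => [|k IH]; first by rewrite expr0 expr1 mul1r mulr1.
rewrite [leRHS]exprS; apply: (@le_trans _ _ ((x + 3) * (x ^+ k * (x + 3 * k.+1%:R)))); last first.
  by apply: ler_wpM2l => //; rewrite addr_ge0.
rewrite exprSr -mulrA [leRHS]mulrCA; apply: ler_wpM2l; first exact: exprn_ge0.
rewrite -[k.+2%:R]natr1 -subr_ge0.
have -> : (x + 3) * (x + 3 * k.+1%:R) - x * (x + 3 * (k.+1%:R + 1)) = 9 * k.+1%:R by ring.
by rewrite mulr_ge0.
Qed.

(** Of order [1 / tau], and large enough for [resample_rate_mixing]: for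
    [tau = k.+1] the probability of staying is [k / (k + 3)]. *)
Definition resample_rate (R : realFieldType) (tau : nat) : R := 3 / (tau%:R + 2).

Lemma resample_rate_bounds (R : realFieldType) (tau : nat) : (0 < tau)%N ->
  0 < resample_rate R tau /\ 0 <= resample_rate R tau <= 1.
Proof.
move=> t0; have t1 : 1 <= tau%:R :> R by rewrite ler1n.
have h : 0 < tau%:R + 2 :> R by lra.
have p0 : 0 < resample_rate R tau by rewrite divr_gt0.
split=> //; rewrite ltW//= ler_pdivrMr// mul1r; lra.
Qed.

Lemma resample_rate_mixing (R : realFieldType) (tau : nat) : (0 < tau)%N ->
  (1 - resample_rate R tau) ^+ tau <= 1 / 4.
Proof.
case: tau => // k _; rewrite /resample_rate -[k.+1%:R]natr1.
set x : R := k%:R; have x0 : 0 <= x by rewrite ler0n.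
have x3 : 0 < x + 3 by lra.
have x3n : x + 3 != 0 by rewrite gt_eqF.
have -> : 1 - 3 / (x + 1 + 2) = x / (x + 3).
  have -> : x + 1 + 2 = x + 3 by ring.
  by field.
rewrite expr_div_n ler_pdivrMr ?exprn_gt0//.
have := bernoulli3 k x0; rewrite -[k.+1%:R]natr1 -/x => h.
have h2 : x ^+ k * (4 * x) <= x ^+ k * (x + 3 * (x + 1)).
  by apply: ler_wpM2l; [exact: exprn_ge0 | lra].
rewrite exprSr; lra.
Qed.

Unset Implicit Arguments.
Set Strict Implicit.

Theorem theorem8 (R : realType) :
  exists2 c : R, 0 < c &
  forall (d tau : nat) (mu sigma1 : R),
    (0 < d)%N -> (0 < tau)%N -> 0 < mu -> 0 < sigma1 ->
  exists N0 : nat, forall N : nat, (N0 <= N)%N ->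
  forall a : one_point_algorithm R d N,
  exists I : one_point_data R d, one_point_instance tau mu sigma1 I /\
  exists xs : 'rV[R]_d, minimizer (objective I) xs /\
    ((c * (Num.sqrt (d%:R * tau%:R * sigma1 ^+ 2) / (mu * Num.sqrt N%:R)))%:E
       <= risk a I xs)%E.
Proof.
exists (1 / 100) => [|d tau mu sigma1 d0 t0 mu0 s0]; first by rewrite divr_gt0.
exists tau => N; case: N => [|n tN a]; first by rewrite leqNgt t0.
have [p0 p01] := resample_rate_bounds R t0.
have mix := resample_rate_mixing R t0.
set p := resample_rate R tau in p0 p01 mix.
have tR : 1 <= tau%:R :> R by rewrite ler1n.
have NR : 0 < n.+1%:R :> R by rewrite ltr0n.
have tNR : tau%:R <= n.+1%:R :> R by rewrite ler_nat.
pose sd : R := Num.sqrt d%:R; pose st : R := Num.sqrt tau%:R.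
pose sN : R := Num.sqrt n.+1%:R.
have sd0 : 0 < sd by rewrite sqrtr_gt0 ltr0n.
have st0 : 0 < st by rewrite sqrtr_gt0 ltr0n.
have sN0 : 0 < sN by rewrite sqrtr_gt0.
have sd2 : sd ^+ 2 = d%:R by rewrite sqr_sqrtr.
have st2 : st ^+ 2 = tau%:R by rewrite sqr_sqrtr.
have sN2 : sN ^+ 2 = n.+1%:R by rewrite sqr_sqrtr.
(* The factor [1 / 4] leaves [eps ^ 2 * (4 * N / tau) = 1 / 4], where
   [4 * N / tau] bounds the expected number of draws once [tau <= N]. *)
pose eps : R := st / sN / 4.
have eps0 : 0 < eps by rewrite !divr_gt0.
have eps2 : eps ^+ 2 = tau%:R / n.+1%:R / 16.
  by rewrite /eps !expr_div_n st2 sN2; congr (_ / _); ring.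
have eps01 : 0 <= eps <= 1.
  have : eps ^+ 2 <= 1 by rewrite eps2 !ler_pdivrMr//; lra.
  by rewrite expr_le1 ?(ltW eps0).
have info : eps ^+ 2 * (1 + n%:R * p) <= 1 / 4.
  have np : tau%:R * p <= 3.
    by rewrite /p /resample_rate mulrCA ler_piMr// ler_pdivrMr; lra.
  have h : n%:R * (tau%:R * p) <= n%:R * 3 by apply: ler_wpM2l.
  rewrite eps2.
  have -> : tau%:R / n.+1%:R / 16 * (1 + n%:R * p)
      = (tau%:R + n%:R * (tau%:R * p)) / n.+1%:R / 16.
    by field; rewrite gt_eqF.
  rewrite ler_pdivrMr// ler_pdivrMr//; move: tNR; rewrite -[n.+1%:R]natr1; lra.
(* The largest [D] that the variance constraint allows. *)
pose D : R := Num.sqrt (2 * eps * sigma1 / (mu * sd)).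
have DD : 0 < 2 * eps * sigma1 / (mu * sd).
  by apply: divr_gt0; [apply: mulr_gt0 => //; exact: mulr_gt0 | exact: mulr_gt0].
have D0 : 0 < D by rewrite sqrtr_gt0.
have D2 : D ^+ 2 = 2 * eps * sigma1 / (mu * sd) by rewrite sqr_sqrtr// ltW.
have var : d%:R * (mu * D ^+ 2 / (2 * eps)) ^+ 2 <= sigma1 ^+ 2.
  rewrite D2 -sd2 le_eqVlt; apply/orP; left; apply/eqP.
  by field; rewrite !gt_eqF.
have [v [P [Y [law hr]]]] := @exists_hard_instance R d n mu D eps p a p01 eps01 info.
exists (hard_instance mu D p01 law); split.
  exact: hard_instance_valid.
exists (landscape_min D v); split.
  by rewrite hard_objective//; exact: landscape_minimizer.
apply: le_trans hr; rewrite lee_fin le_eqVlt; apply/orP; left; apply/eqP.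
have -> : Num.sqrt (d%:R * tau%:R * sigma1 ^+ 2) = sd * st * sigma1.
  by rewrite sqrtrM ?mulr_ge0// sqrtrM// sqrtr_sqr gtr0_norm.
rewrite expr_div_n D2 -/sN -sd2 /eps.
by field; rewrite !gt_eqF.
Qed.
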